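(* Let $(N_t)_{t\ge0}$ be a branching process on $\mathbb N_0^*$ with transition kernels $(\ell_{s,t})$ and probability generating functions $(F_{s,t})_{(s,t)\in\Delta}$. The following are equivalent: (i) $(N_t)$ is spatially embeddable into a branching process on $[0,\infty]$; (ii) $F_{s,t}(0)=0$ for all $(s,t)\in\Delta$; (iii) $\ell_{s,t}(n,\{m\})=0$ for all $(s,t)\in\Delta$ and $m,n\in\mathbb N_0$ with $m<n$; (iv) $\mathbb P^{(s,n)}[N_t\le N_u]=1$ for all $0\le s\le t\le u$ and $n\in\mathbb N_0$.
   Context: $\Delta=\{(s,t):0\le s\le t\}$, $\mathbb N_0^*=\{0,1,2,\dots\}\cup\{\infty\}$ with its natural compact topology; $(k\star l)(x,B)=\int l(y,B)k(x,\mathrm dy)$, $\ast$ = convolution. A branching process on $\mathbb N_0^*$ is a Markov family $(N_t)$ (probabilities $\mathbb P^{(s,n)}$ with $\mathbb P^{(s,n)}[N_s=n]=1$ and $\mathbb E^{(s,n)}[f(N_u)|\mathcal F_{[s,t]}]=\int f(y)\ell_{t,u}(N_t,\mathrm dy)$ a.s.) whose transition kernels $(\ell_{s,t})$ on $\mathbb N_0^*$ satisfy: $\ell_{s,s}(n,\cdot)=\delta_n$; $\ell_{s,t}\star\ell_{t,u}=\ell_{s,u}$; for $n\in\mathbb N_0$, $(s,t)\mapsto\ell_{s,t}(n,\cdot)$ weakly continuous; $\ell_{s,t}(m,\cdot)\ast\ell_{s,t}(n,\cdot)=\ell_{s,t}(m+n,\cdot)$ for $m,n\in\mathbb N_0$;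 $\ell_{s,t}(0,\cdot)=\delta_0$; $\ell_{s,t}(\infty,\cdot)=\delta_\infty$. Probability generating functions: $F_{s,t}(z)=\sum_{n\ge0}\ell_{s,t}(1,\{n\})z^n$, $|z|<1$. A family of transition kernels of a branching process on $[0,\infty]$ is a family $(k_{s,t})$ of transition kernels on $[0,\infty]$ with $k_{s,s}(x,\cdot)=\delta_x$, $k_{s,t}\star k_{t,u}=k_{s,u}$, weak continuity of $(s,t,x)\mapsto k_{s,t}(x,\cdot)$ on $\Delta\times[0,\infty)$, $k_{s,t}(x,\cdot)\ast k_{s,t}(y,\cdot)=k_{s,t}(x+y,\cdot)$ for $x,y\in[0,\infty)$, $k_{s,t}(0,\cdot)=\delta_0$, $k_{s,t}(\infty,\cdot)=\delta_\infty$. $(N_t)$ is spatially embeddable into a branching process on $[0,\infty]$ if there is such a family $(k_{s,t})$ with $k_{s,t}(n,B)=\ell_{s,t}(n,B\cap\mathbb N_0^* )$ for all $n\in\mathbb N_0^*$, $(s,t)\in\Delta$ and Borel $B\subset[0,\infty]$. *)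

(* Defs.v *)
From HB Require Import structures.
From mathcomp Require Import all_boot all_order all_algebra.
From mathcomp Require Import all_classical all_reals all_analysis measurable_realfun.

Set Implicit Arguments.
Unset Strict Implicit.
Unset Printing Implicit Defensive.

Import Order.TTheory GRing.Theory Num.Theory.
Import numFieldNormedType.Exports.
Local Open Scope classical_set_scope.
Local Open Scope ring_scope.

(* The state space N_0^* = {0,1,2,...} u {oo}:  Some n = n,  None = oo *)
Definition natinf : Type := option nat.
HB.instance Definition _ := Choice.copy natinf (option nat).
HB.instance Definition _ := isPointed.Build natinf None.
(* discrete sigma-algebra (all subsets), the Borel sets of the compact
   space N_0^* *)
HB.instance Definition _ := @isMeasurable.Build default_measure_display
  natinf discrete_measurable discrete_measurable0
  discrete_measurableC discrete_measurableU.

Definition natinf_add (x y : natinf) : natinf :=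
  match x, y with Some m, Some n => Some (m + n)%N | _, _ => None end.

Definition natinf_le (x y : natinf) : Prop :=
  match x, y with
  | Some m, Some n => (m <= n)%N
  | _, None => True
  | None, Some _ => False
  end.

(* continuity of f : N_0^* -> R for the natural compact topology of N_0^*
   (one-point compactification of the discrete space N_0) *)
Definition natinf_continuous {R : realType} (f : natinf -> R) : Prop :=
  (fun k : nat => f (Some k)) @ \oo --> f None.

Definition natinf_emb {R : realType} (x : natinf) : \bar R :=
  match x with Some n => (n%:R)%:E | None => +oo%E end.

Definition Delta {R : realType} : set (R * R) :=
  [set st | 0 <= st.1 /\ st.1 <= st.2].

Definition Einf {R : realType} : set (\bar R) := [set x | (0 <= x)%E].

Section natinf_kernels.
Variable R : realType.
Local Notation kerN := (R -> R -> natinf -> probability natinf R).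

Definition convN (mu nu : probability natinf R) (B : set natinf) : \bar R :=
  (\int[mu]_x \int[nu]_y (\1_B (natinf_add x y) : R)%:E)%E.

Definition starN (k l : probability natinf R) (L : natinf -> set natinf -> \bar R)
  (B : set natinf) : \bar R := (\int[k]_y L y B)%E.

Definition is_branching_kernel_N (l : kerN) : Prop :=
  [/\ (forall s x B, 0 <= s -> l s s x B = \d_x B),
      (forall s t u x B, 0 <= s -> s <= t -> t <= u ->
         (\int[l s t x]_y l t u y B)%E = l s u x B),
      (forall n : nat, forall f : natinf -> R, natinf_continuous f ->
         {within (@Delta R), continuous
            (fun st : R * R => Rintegral (l st.1 st.2 (Some n)) setT f)})
    & [/\ (forall s t (m n : nat) B, (s, t) \in (@Delta R) ->
         convN (l s t (Some m)) (l s t (Some n)) B = l s t (Some (m + n)%N) B),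
      (forall s t B, (s, t) \in (@Delta R) -> l s t (Some 0%N) B = \d_(Some 0%N : natinf) B)
    & (forall s t B, (s, t) \in (@Delta R) -> l s t None B = \d_(None : natinf) B)]].

Definition pgf (l : kerN) (s t z : R) : R :=
  limn (fun N => \sum_(0 <= n < N) fine (l s t (Some 1%N) [set (Some n : natinf)]) * z ^+ n).

End natinf_kernels.

Definition natural_sigma {d} {Omega : measurableType d} {R : realType}
  (N : R -> Omega -> natinf) (s t : R) : set (set Omega) :=
  <<s [set A | exists r B, s <= r /\ r <= t /\ A = N r @^-1` B] >>.

Definition is_markov_family {d} {Omega : measurableType d} {R : realType}
  (l : R -> R -> natinf -> probability natinf R)
  (N : R -> Omega -> natinf) (P : R -> natinf -> probability Omega R) : Prop :=
  [/\ (forall r, 0 <= r -> measurable_fun setT (N r)),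
      (forall s x, 0 <= s -> P s x [set w | N s w = x] = 1%E)
    & (* E^{(s,x)}[f(N_u) | F_{[s,t]}] = int f(y) l_{t,u}(N_t, dy)  a.s.,
         written out via the defining property of conditional expectation *)
      (forall s t u x (f : natinf -> R), 0 <= s -> s <= t -> t <= u ->
         (exists M : R, forall y, `|f y| <= M) ->
         forall A, natural_sigma N s t A ->
           (\int[P s x]_(w in A) (f (N u w))%:E)%E =
           (\int[P s x]_(w in A) (Rintegral (l t u (N t w)) setT f)%:E)%E)].

Definition is_branching_process {d} {Omega : measurableType d} {R : realType}
  (l : R -> R -> natinf -> probability natinf R)
  (N : R -> Omega -> natinf) (P : R -> natinf -> probability Omega R) : Prop :=
  is_markov_family l N P /\ is_branching_kernel_N l.

(* k s t x = k_{s,t}(x, .), a probability on \bar R concentrated on    *)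
(* [0, oo]; only x in [0, oo] is relevant.                             *)
Section einf_kernels.
Variable R : realType.
Local Notation kerE := (R -> R -> \bar R -> probability (\bar R) R).

Definition convE (mu nu : probability (\bar R) R) (B : set (\bar R)) : \bar R :=
  (\int[mu]_(x in Einf) \int[nu]_(y in Einf) (\1_B (x + y)%E : R)%:E)%E.

Definition is_branching_kernel_E (k : kerE) : Prop :=
  [/\
      (forall s t x, (s, t) \in (@Delta R) -> Einf x -> k s t x Einf = 1%E),
      (forall s t B, (s, t) \in (@Delta R) -> measurable B -> B `<=` Einf ->
         measurable_fun Einf (fun x => k s t x B)),
      (forall s x B, 0 <= s -> Einf x -> measurable B -> B `<=` Einf ->
         k s s x B = \d_x B),
      (forall s t u x B, 0 <= s -> s <= t -> t <= u -> Einf x ->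
         measurable B -> B `<=` Einf ->
         (\int[k s t x]_(y in Einf) k t u y B)%E = k s u x B)
    & [/\
      (forall f : \bar R -> R, {within Einf, continuous f} ->
         {within [set stx : (R * R) * R | stx.1 \in (@Delta R) /\ 0 <= stx.2],
           continuous (fun stx : (R * R) * R =>
             Rintegral (k stx.1.1 stx.1.2 stx.2%:E) Einf f)}),
      (forall s t (x y : R) B, (s, t) \in (@Delta R) -> 0 <= x -> 0 <= y ->
         measurable B -> B `<=` Einf ->
         convE (k s t x%:E) (k s t y%:E) B = k s t (x + y)%:E B),
      (forall s t B, (s, t) \in (@Delta R) -> measurable B -> B `<=` Einf ->
         k s t 0%E B = \d_(0%E) B)
    & (forall s t B, (s, t) \in (@Delta R) -> measurable B -> B `<=` Einf ->
         k s t +oo%E B = \d_(+oo%E) B)]].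

Definition spatially_embeddable
  (l : R -> R -> natinf -> probability natinf R) : Prop :=
  exists k : kerE, is_branching_kernel_E k /\
    forall s t (n : natinf) (B : set (\bar R)), (s, t) \in (@Delta R) ->
      measurable B -> B `<=` Einf ->
      k s t (natinf_emb n) B = l s t n (natinf_emb @^-1` B).

End einf_kernels.

(* Main.v *)
Require Import Defs.
From HB Require Import structures.
From mathcomp Require Import all_boot all_order all_algebra.
From mathcomp Require Import all_classical all_reals all_analysis measurable_realfun.
From mathcomp Require Import ring lra zify.
From mathcomp Require Import polyrcf.

Set Implicit Arguments.
Unset Strict Implicit.
Unset Printing Implicit Defensive.

Import Order.TTheory GRing.Theory Num.Theory.
Import numFieldNormedType.Exports.
Local Open Scope classical_set_scope.
Local Open Scope ring_scope.

(**
If no particle dies, then [l_{s,t}(m, {m + n}) = p^m Q_n(m)] for all [m], with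
[p = l_{s,t}(1, {1}) > 0] and a polynomial [Q_n], namely the coefficient of
[z^n] in [(F_{s,t}(z) / (p z))^m]. Polynomials agreeing on the naturals are
equal, so the convolution and Chapman-Kolmogorov identities persist for the
weights [p^x Q_n(x)], [x >= 0] real, and [k_{s,t}(x, .)] is the law putting
mass [p^x Q_n(x)] on [x + n] and the remaining mass on [+oo].

The point is [Q_n(x) >= 0]. Since [Q_n' = \sum_i Q_i c_{n-i}] with
[c_n = Q_n'(0)], it suffices that [c_n >= 0]. The identity
[c^{s,u}_n = c^{t,u}_n + \sum_j c^{s,t}_j l_{t,u}(j, {n})] makes the sum of the
negative parts of [c_0, ..., c_N] subadditive over adjacent time intervals,
while over short intervals this sum is [O((1/p - 1)^2)] and [1/p - 1] is
superadditive; hence it vanishes.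

Conversely, suppose [F_{s,t}(0) > 0] for some [s <= t]. There is a time [tau]
with [F_{tau,u}(0) > 0] for all [u > tau] close to [tau]. Then
[k_{tau,u}(1/2, .)] charges [0], and as its convolution square is carried by
the integers, it does not charge [(0, 1)]; this contradicts
[k_{tau,u}(1/2, .) -> \d_{1/2}] as [u -> tau].
*)

(** * Polynomial interpolation of the powers of a power series *)

Section power_polynomials.
Variable R : realType.
Implicit Types (p q : {poly R}).

Lemma poly_eq_nat p q : (forall m : nat, p.[m%:R] = q.[m%:R]) -> p = q.
Proof.
move=> pq; apply/eqP; rewrite -subr_eq0; apply/negPn/negP => nz.
have := @max_poly_roots R (p - q) [seq (i%:R : R) | i <- iota 0 (size (p - q))] nz.
rewrite size_map size_iota ltnn; case/(_ _ _)/negP => //.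
  by apply/allP => x /mapP[i _ ->]; rewrite /root !hornerE pq subrr.
by rewrite map_inj_uniq ?iota_uniq// => i j /eqP; rewrite eqr_nat => /eqP.
Qed.

Lemma horner_deriv_sum (I : Type) (r : seq I) (F : I -> {poly R}) x :
  (\sum_(i <- r) F i)^`().[x] = \sum_(i <- r) (F i)^`().[x].
Proof. by rewrite (raddf_sum (@deriv R)) horner_sum. Qed.

Definition binpoly (k : nat) : {poly R} :=
  (k`!%:R)^-1 *: \prod_(i < k) ('X - (i%:R)%:P).

Lemma binpoly_nat k m : (binpoly k).[m%:R] = 'C(m, k)%:R.
Proof.
rewrite /binpoly hornerZ horner_prod.
have -> : \prod_(i < k) ('X - (i%:R)%:P).[m%:R] = (m ^_ k)%:R :> R.
  rewrite ffact_prod natr_prod.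
  have [km|mk] := leqP k m.
    apply: eq_bigr => i _; rewrite !hornerE natrB//.
    exact: leq_trans (ltnW (ltn_ord i)) km.
  rewrite (bigD1 (Ordinal mk))//= !hornerE subrr mul0r.
  by rewrite (bigD1 (Ordinal mk))//= subnn mul0r.
rewrite -bin_ffact natrM mulrC mulfK// pnatr_eq0 -lt0n; exact: fact_gt0.
Qed.

(** With [g] the power series [1 + r 1 z + r 2 z^2 + ...], this is the coefficient of [z^n] in the
    binomial series of [g^x], the sum over [k] of [binpoly k] at [x] times [(g - 1)^k], seen as a
    polynomial in [x]. Since [g - 1] has no constant term, the powers [k > n] do not reach [z^n]. *)
Definition powpoly (r : nat -> R) (n : nat) : {poly R} :=
  \sum_(k < n.+1) ((\poly_(i < n.+1) (if i == 0%N then 0 else r i)) ^+ k)`_n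
     *: binpoly k.

Lemma coef_exp_small p k n : p`_0 = 0 -> (n < k)%N -> (p ^+ k)`_n = 0.
Proof.
move=> p0; elim: k n => // k IH n nk; rewrite exprS coefM big1// => i _.
case: i => -[|i] /= ilt; first by rewrite p0 mul0r.
by rewrite IH ?mulr0//; lia.
Qed.

Section convolution_semigroup.
Variable b : nat -> nat -> R.
Hypothesis b0 : forall n, b 0 n = (n == 0%N)%:R.
Hypothesis bD : forall m m' n,
  b (m + m')%N n = \sum_(i < n.+1) b m i * b m' (n - i)%N.
Hypothesis b1 : b 1 0 = 1.

Lemma coef_pow_semigroup m n K : (n <= K)%N ->
  b m n = ((\poly_(i < K.+1) b 1 i) ^+ m)`_n.
Proof.
elim: m n => [|m IH] n nK; first by rewrite b0 expr0 coef1.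
rewrite -addn1 bD exprD expr1 coefM; apply: eq_bigr => i _.
rewrite -IH; last by case: i => i /=; lia.
by rewrite coef_poly ifT//; case: i => i /=; lia.
Qed.

Lemma powpoly_nat n m : (powpoly (b 1) n).[m%:R] = b m n.
Proof.
rewrite (@coef_pow_semigroup m n n)//.
set rp := \poly_(i < n.+1) (if i == 0%N then 0 else b 1 i).
have -> : \poly_(i < n.+1) b 1 i = 1 + rp.
  apply/polyP => i; rewrite coefD coef1 !coef_poly.
  by case: i => [|i] /=; rewrite ?b1 ?addr0 ?add0r.
have rp0 : rp`_0 = 0 by rewrite coef_poly.
(* The range is wide enough for both [k <= n], from [powpoly], and [k <= m], from the binomial
   theorem. Surplus terms vanish: for [k > n] through the coefficient of [rp ^+ k], for [k > m]
   through the binomial coefficient. *)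
pose T := \sum_(k < (m + n).+1) (rp ^+ k)`_n *+ 'C(m, k).
transitivity T.
  rewrite /T /powpoly horner_sum -/rp.
  rewrite (big_ord_widen_cond (m + n).+1 xpredT
    (fun k => ((rp ^+ k)`_n *: binpoly k).[m%:R])); last by rewrite ltnS leq_addl.
  rewrite [RHS](bigID (fun k : 'I__ => (k < n.+1)%N))/= [X in _ = _ + X]big1 ?addr0.
    by apply: eq_bigr => k _; rewrite hornerZ binpoly_nat mulr_natr.
  by move=> k; rewrite -leqNgt => nk; rewrite coef_exp_small// mul0rn.
rewrite exprDn coef_sum /T.
rewrite [RHS](big_ord_widen_cond (m + n).+1 xpredT
    (fun k => (1 ^+ (m - k) * rp ^+ k *+ 'C(m, k))`_n)); last by rewrite ltnS leq_addr.
rewrite [LHS](bigID (fun k : 'I__ => (k < m.+1)%N))/= [X in _ + X = _]big1 ?addr0.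
  by apply: eq_bigr => k _; rewrite coefMn expr1n mul1r.
by move=> k; rewrite -leqNgt => nk; rewrite bin_small// mulr0n.
Qed.

Let Q := powpoly (b 1).
Let c n := (Q n)^`().[0].

Lemma powpoly0 : Q 0 = 1.
Proof.
apply: poly_eq_nat => m; rewrite powpoly_nat hornerC.
elim: m => [|m IH]; first by rewrite b0.
by rewrite -addn1 bD big_ord1 subnn IH b1 mulr1.
Qed.

(** For natural arguments this is [bD]. It is extended to the reals one variable at a time, as an
    identity of polynomials first in [x] with [y] natural, then in [y] with [x] real. *)
Lemma powpolyD n x y : (Q n).[x + y] = \sum_(i < n.+1) (Q i).[x] * (Q (n - i)).[y].
Proof.
have H (m : nat) z : (Q n).[z + m%:R] = \sum_(i < n.+1) (Q i).[z] * b m (n - i).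
  have -> : (Q n).[z + m%:R] = (Q n \Po ('X + m%:R%:P)).[z].
    by rewrite horner_comp !hornerE.
  have -> : \sum_(i < n.+1) (Q i).[z] * b m (n - i) =
     (\sum_(i < n.+1) b m (n - i) *: Q i).[z].
    by rewrite horner_sum; apply: eq_bigr => i _; rewrite hornerZ mulrC.
  congr horner; apply: poly_eq_nat => m'.
  rewrite horner_comp !hornerE -natrD powpoly_nat bD horner_sum.
  by apply: eq_bigr => i _; rewrite hornerZ powpoly_nat mulrC.
have -> : (Q n).[x + y] = (Q n \Po (x%:P + 'X)).[y].
  by rewrite horner_comp !hornerE.
have -> : \sum_(i < n.+1) (Q i).[x] * (Q (n - i)).[y] =
   (\sum_(i < n.+1) (Q i).[x] *: Q (n - i)).[y].
  by rewrite horner_sum; apply: eq_bigr => i _; rewrite hornerZ.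
congr horner; apply: poly_eq_nat => m.
rewrite horner_comp !hornerE H horner_sum.
by apply: eq_bigr => i _; rewrite hornerZ powpoly_nat.
Qed.

(** This is the derivative of the addition formula in its second variable at [0]. *)
Lemma deriv_powpoly n x : (Q n)^`().[x] = \sum_(i < n.+1) (Q i).[x] * c (n - i).
Proof.
have E : Q n \Po (x%:P + 'X) = \sum_(i < n.+1) (Q i).[x] *: Q (n - i).
  apply: poly_eq_nat => m; rewrite horner_comp !hornerE powpolyD horner_sum.
  by apply: eq_bigr => i _; rewrite hornerZ.
move/(congr1 (fun p => p^`().[0])): E.
rewrite deriv_comp derivD derivC derivX add0r mulr1 horner_comp !hornerE => ->.
rewrite horner_deriv_sum; apply: eq_bigr => i _.
by rewrite derivZ hornerZ.
Qed.

(** Strong induction on [n]. As [c 0 = 0], the derivative of [Q n] involves only the [Q i] with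
    [i < n], so it is nonnegative on the positive half-line; for [n > 0] moreover [Q n] vanishes at
    [0], and the mean value theorem concludes. *)
Lemma powpoly_ge0 n x : (forall k, (k <= n)%N -> 0 <= c k) -> 0 <= x -> 0 <= (Q n).[x].
Proof.
elim/ltn_ind: n x => n IH x c0 x0.
have [->|n0] := eqVneq n 0%N; first by rewrite powpoly0 hornerC.
have Q0 : (Q n).[0] = 0 by rewrite (powpoly_nat n 0) b0 (negbTE n0).
rewrite -Q0; move: x0; rewrite le_eqVlt => /predU1P[<-//|x0].
have [z /andP[z0 zx]] := poly_mvt (Q n) x0.
move/eqP; rewrite subr_eq => /eqP ->; rewrite lerDr mulr_ge0//; last by rewrite subr0 ltW.
rewrite deriv_powpoly; apply: sumr_ge0 => i _.
have [ni|ni] := eqVneq (i : nat) n.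
  have -> : (n - i = 0)%N by lia.
  by rewrite /c powpoly0 derivC hornerC mulr0.
have iltn : (i < n)%N by case: i ni => i /= ilt; lia.
apply: mulr_ge0; last by apply: c0; lia.
apply: IH => //; last exact: ltW.
by move=> k ki; apply: c0; lia.
Qed.

(** In the derivative of the binomial series at [0], the term [k = 0] vanishes and the term [k = 1]
    is a coefficient of [rp], hence nonnegative. For [k >= 2] the coefficient of [rp ^+ k] is at
    most [rp.[1] ^+ k], which is at most [rho ^+ 2]. *)
Lemma deriv_powpoly_lower n rho :
  (forall k, 0 <= b 1 k) -> \sum_(1 <= k < n.+1) b 1 k <= rho -> rho <= 1 ->
  - (\sum_(k < n.+1) `|(binpoly k)^`().[0]|) * rho ^+ 2 <= c n.
Proof.
move=> bge brho rho1.
rewrite /c /Q /powpoly horner_deriv_sum mulNr mulr_suml -sumrN.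
set rp := \poly_(i < n.+1) (if i == 0%N then 0 else b 1 i).
have rpge i : 0 <= rp`_i.
  by rewrite coef_poly; case: ifP => // _; case: ifP.
have rpk_ge k i : 0 <= (rp ^+ k)`_i.
  elim: k i => [|k IH] i; first by rewrite coef1 ler0n.
  by rewrite exprS coefM sumr_ge0// => j _; apply: mulr_ge0.
have rp1 : 0 <= rp.[1] <= rho.
  rewrite (horner_poly) big_ord_recl/= mul0r add0r.
  apply/andP; split; first by apply: sumr_ge0 => i _; rewrite expr1n mulr1.
  apply: le_trans brho; rewrite big_add1/= big_mkord.
  by apply: ler_sum => i _; rewrite expr1n mulr1.
have le1 q : (forall i, 0 <= q`_i) -> q`_n <= q.[1].
  move=> qge; have [sn|sn] := leqP (size q) n.
    rewrite nth_default//  horner_coef sumr_ge0// => i _; by rewrite expr1n mulr1.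
  rewrite horner_coef (bigD1 (Ordinal sn))//= expr1n mulr1 lerDl.
  by rewrite sumr_ge0// => i _; rewrite expr1n mulr1.
apply: ler_sum => -[k kn] _ /=.
rewrite derivZ hornerZ.
case: k kn => [|[|k]] kn.
- have -> : binpoly 0 = 1 by rewrite /binpoly big_ord0 fact0 invr1 scale1r.
  by rewrite derivC horner0 normr0 mulr0 mul0r oppr0.
- have -> : binpoly 1 = 'X.
    by rewrite /binpoly big_ord1 factS fact0 muln1 invr1 scale1r subr0.
  rewrite derivX hornerC normr1 mul1r mulr1 (le_trans _ (rpk_ge 1%N n))//.
  by rewrite oppr_le0 sqr_ge0.
- rewrite lerNl -mulrN; apply: le_trans (ler_norm _) _.
  rewrite normrM normrN ger0_norm ?rpk_ge// mulrC; apply: ler_wpM2l => //.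
  apply: le_trans (le1 _ _) _; first exact: rpk_ge.
  rewrite horner_exp; case/andP: rp1 => r0 rr.
  apply: (@le_trans _ _ (rho ^+ k.+2)).
    by rewrite lerXn2r// nnegrE (le_trans r0).
  by rewrite -(addn2 k) exprD ler_piMl ?sqr_ge0// exprn_ile1// (le_trans r0).
Qed.

End convolution_semigroup.
End power_polynomials.

(** * Probability measures on [natinf] *)

Lemma measurable_natinf (A : set natinf) : measurable A.
Proof. by []. Qed.

Lemma measurable_fun_natinf d (T : measurableType d) (D : set natinf) (f : natinf -> T) :
  measurable_fun D f.
Proof. by []. Qed.

#[local] Hint Resolve measurable_natinf measurable_fun_natinf : core.

Section natinf_measures.
Variable R : realType.
Implicit Types mu nu : probability natinf R.

(** The mass at [None] is what the finite points leave of the total mass [1]. Identities between the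
    kernels [kE] are reduced to identities between weights in this way. *)
Lemma probability_natinf_ext mu nu :
  (forall n, mu [set Some n] = nu [set Some n]) -> forall B, mu B = nu B.
Proof.
move=> munu B.
have fin_part B' : mu (B' `&` range Some) = nu (B' `&` range Some).
  have -> : B' `&` range Some = \bigcup_(n in Some @^-1` B') [set (Some n : natinf)].
    apply/seteqP; split => [x [Bx [n _ nx]]|x [n Bn /= ->]]; last by split => //; exists n.
    by exists n => //=; rewrite ?nx.
  have tI : trivIset (Some @^-1` B') (fun n => [set (Some n : natinf)]).
    by move=> i j _ _ [x [/= -> []]].
  rewrite !measure_bigcup//; apply: eq_eseriesr => n _; exact: munu.
have none_part : mu [set None] = nu [set None].
  have -> : [set None] = ~` (setT `&` range (@Some nat)) :> set natinf.
    apply/seteqP; split => [x -> [_ [n _]]//|x]; case: x => //= n H.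
    by exfalso; apply: H; split=> //; exists n.
  by rewrite !probability_setC// fin_part.
have -> : B = (B `&` range Some) `|` (B `&` [set None]).
  apply/seteqP; split => [x Bx|x [[]|[]]]//.
  by case: x Bx => [n|] Bx; [left; split => //; exists n|right].
have dis : (B `&` range Some) `&` (B `&` [set None]) = set0.
  by apply/seteqP; split => // x [[_ [n _ <-]] [_ ]].
rewrite !measureU//; congr (_ + _)%E; first exact: fin_part.
have [BN|BN] := pselect (B None).
  have -> : B `&` [set None] = [set None] :> set natinf.
    by apply/seteqP; split => [x []//|x ->].
  exact: none_part.
have -> : B `&` [set None] = set0 :> set natinf.
  by apply/seteqP; split => // x [+ xN]; rewrite xN.
by rewrite !measure0.
Qed.

Lemma integral_natinf_finite mu (f : natinf -> \bar R) n :
  (forall x, 0 <= f x)%E -> f None = 0%E ->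
  (forall i, (n < i)%N -> f (Some i) = 0%E) ->
  (\int[mu]_x f x = \sum_(i < n.+1) f (Some (i : nat)) * mu [set Some (i : nat)])%E.
Proof.
move=> f0 fN fn.
rewrite (eq_integral (fun x : natinf =>
  \sum_(i < n.+1) (f (Some (i : nat)) * (\1_[set (Some (i : nat) : natinf)] x)%:E)))%E.
  rewrite ge0_integral_sum//; last first.
    by move=> i x _; rewrite mule_ge0// lee_fin.
  apply: eq_bigr => i _; rewrite ge0_integralZl//.
  by rewrite integral_indic// setIT.
move=> x _; case: x => [m|].
  have [mn|nm] := leqP m n.
    rewrite (bigD1 (Ordinal (mn : (m < n.+1)%N)))//= indicE mem_set// mule1.
    rewrite big1 ?adde0// => i im; rewrite indicE memNset ?mule0//= => -[mi].
    by move/eqP : im; apply; apply: val_inj.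
  rewrite fn// big1// => i _; rewrite indicE memNset ?mule0//= => -[mi].
  by have := ltn_ord i; lia.
rewrite fN big1// => i _; rewrite indicE memNset ?mule0//=.
Qed.

Section push.
Context d (T : measurableType d) mu (f : natinf -> T).

(** Every function out of the discrete space [natinf] is measurable, so this image measure is a
    probability for arbitrary [f]. *)
Definition pushN (B : set T) : \bar R := mu (f @^-1` B).

Let pushN0 : pushN set0 = 0%E.
Proof. by rewrite /pushN preimage_set0 measure0. Qed.

Let pushN_ge0 B : (0 <= pushN B)%E.
Proof. exact: measure_ge0. Qed.

Let pushN_sigma_additive : semi_sigma_additive pushN.
Proof.
move=> F mF tF mUF; rewrite /pushN preimage_bigcup.
apply: measure_semi_sigma_additive => //.
apply/trivIsetP => /= i j _ _ ij; rewrite -preimage_setI.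
by move/trivIsetP : tF => /(_ _ _ _ _ ij) ->//; rewrite preimage_set0.
Qed.

HB.instance Definition _ := isMeasure.Build _ _ _
  pushN pushN0 pushN_ge0 pushN_sigma_additive.

Let pushNT : pushN setT = 1%E.
Proof. by rewrite /pushN preimage_setT probability_setT. Qed.

HB.instance Definition _ := Measure_isProbability.Build _ _ _ pushN pushNT.

Lemma ge0_integral_pushN (D : set T) (g : T -> \bar R) :
  measurable D -> measurable_fun D g -> (forall y, D y -> 0 <= g y)%E ->
  (\int[pushN]_(y in D) g y = \int[mu]_(x in f @^-1` D) g (f x))%E.
Proof.
move=> mD mg g0.
have mf : measurable_fun setT f by [].
rewrite -[RHS](ge0_integral_pushforward mf mu mD mg); last first.
  by move=> y; rewrite inE; exact: g0.
by apply: eq_measure_integral => A mA _.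
Qed.

End push.

Section bind.
Variables (mu : probability natinf R) (K : natinf -> probability natinf R).

(** Convolutions and compositions of kernels are both mixtures of this form. Having the mixture as a
    probability makes [probability_natinf_ext] applicable to them. *)
Definition bindN (B : set natinf) : \bar R := (\int[mu]_y K y B)%E.

Let bindN0 : bindN set0 = 0%E.
Proof. by rewrite /bindN; apply: integral0_eq => x _; rewrite measure0. Qed.

Let bindN_ge0 B : (0 <= bindN B)%E.
Proof. exact: integral_ge0. Qed.

Let bindN_sigma_additive : semi_sigma_additive bindN.
Proof.
move=> F mF tF mUF; rewrite /bindN.
rewrite (eq_integral (fun y => \sum_(0 <= n <oo) K y (F n)))%E; last first.
  by move=> y _; rewrite measure_semi_bigcup.
rewrite integral_nneseries//.
by apply: is_cvg_nneseries => n _ _; exact: integral_ge0.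
Qed.

HB.instance Definition _ := isMeasure.Build _ _ _
  bindN bindN0 bindN_ge0 bindN_sigma_additive.

Let bindNT : bindN setT = 1%E.
Proof.
rewrite /bindN (eq_integral (cst 1%E)); last by move=> y _; rewrite probability_setT.
by rewrite integral_cst// mul1e; exact: probability_setT.
Qed.

HB.instance Definition _ := Measure_isProbability.Build _ _ _ bindN bindNT.

Lemma bindN_finite n : K None [set Some n] = 0%E ->
  (forall i, (n < i)%N -> K (Some i) [set Some n] = 0%E) ->
  bindN [set Some n] =
    (\sum_(i < n.+1) K (Some (i : nat)) [set Some n] * mu [set Some (i : nat)])%E.
Proof. by move=> KN Ki; apply: integral_natinf_finite. Qed.

End bind.

Section weights.
Variable h : nat -> R.
Hypothesis h0 : forall n, 0 <= h n.
Hypothesis h1 : forall n, \sum_(i < n) h i <= 1.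

Let S := limn (fun n => \sum_(i < n) h i).

Let cvgS : (fun n => \sum_(i < n) h i) @ \oo --> S.
Proof.
apply: nondecreasing_is_cvgn.
  by apply/nondecreasing_seqP => n; rewrite big_ord_recr/= lerDl.
by exists 1 => _ [n _ <-].
Qed.

Let S1 : 0 <= 1 - S.
Proof.
rewrite subr_ge0; apply: (limr_le (cvgP _ cvgS)).
by near=> n; exact: h1.
Unshelve. all: by end_near. Qed.

(** Index [0] places the missing mass [1 - S] on [None], and index [n.+1] places [h n] on [Some n];
    [e] gives the locations. *)
Let w (n : nat) : {nonneg R} :=
  match n with 0 => NngNum S1 | n.+1 => NngNum (h0 n) end.

Let e (n : nat) : natinf := match n with 0 => None | n.+1 => Some n end.

Definition weightN := mseries (fun n => mscale (w n) (\d_(e n))) 0.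

HB.instance Definition _ := Measure.on weightN.

Let weightNT : weightN setT = 1%E.
Proof.
rewrite /weightN /mseries.
apply/cvg_lim => //; rewrite -(@cvg_shiftS _).
have -> : (fun n => \sum_(0 <= k < n.+1) mscale (w k) (\d_(e k)) setT)%E =
  EFin \o (fun n => 1 - S + \sum_(i < n) h i).
  apply/funext => n /=; rewrite big_nat_recl// big_mkord EFinD -sumEFin.
  congr (_ + _)%E; first by rewrite /mscale/= diracT mule1.
  by apply: eq_bigr => i _; rewrite /mscale/= diracT mule1.
apply/cvg_EFin; first exact: nearW.
have H : (fun n => 1 - S + \sum_(i < n) h i) @ \oo --> 1 - S + S.
  by apply: cvgD; [exact: cvg_cst|exact: cvgS].
by rewrite subrK in H; exact: H.
Unshelve. all: by end_near. Qed.

HB.instance Definition _ := Measure_isProbability.Build _ _ _ weightN weightNT.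

Lemma weightN1 n : weightN [set Some n] = (h n)%:E.
Proof.
rewrite /weightN /mseries; apply/cvg_lim => //.
apply: cvg_near_cst; exists n.+2 => // m /= nm.
rewrite (bigD1_seq n.+1)/=; first last.
- exact: iota_uniq.
- by rewrite mem_index_iota; lia.
rewrite big1; first by rewrite /mscale/= diracE mem_set// mule1 adde0.
move=> i ni; rewrite /mscale/= diracE memNset ?mule0//=.
by case: i ni => // i ni [] iE; rewrite iE eqxx in ni.
Qed.

End weights.

Lemma probability_of_weights (h : nat -> R) :
  (forall n, 0 <= h n) -> (forall n, \sum_(i < n) h i <= 1) ->
  exists mu : probability natinf R, forall n, mu [set Some n] = (h n)%:E.
Proof.
by move=> h0 h1; exists (weightN h0 h1) => n; exact: weightN1.
Qed.

End natinf_measures.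

(** * Induction over time intervals and a shift of sums *)

Lemma interval_induction (R : realType) (B : R -> R -> Prop) (s u : R) : s <= u ->
  (forall a b c, s <= a -> a <= b -> b <= c -> c <= u -> B a b -> B b c -> B a c) ->
  (forall tau, s <= tau -> tau <= u -> exists2 d, 0 < d &
     forall a b, s <= a -> a <= b -> b <= u -> tau - d < a -> b < tau + d -> B a b) ->
  B s u.
Proof.
move=> su Btrans Bloc.
(* As [B] holds on short intervals around [sup S], a point of [S] close to [sup S] can be prolonged
   to [b'], which is either [u] or larger than [sup S]. The second case is absurd. *)
pose S := [set b | [/\ s <= b, b <= u & B s b]].
have Ss : S s.
  by split => //; have [d d0] := Bloc s (lexx s) su; apply; lra.
have ubS : ubound S u by move=> b [].
have supS : has_sup S by split; [exists s|exists u].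
have s_sup : s <= sup S by apply: ub_le_sup => //; exists u.
have sup_u : sup S <= u by apply: ge_sup => //; exists s.
have [d d0 Bd] := Bloc _ s_sup sup_u.
have [b [sb bu Bsb] bd] := sup_adherent d0 supS.
have b_sup : b <= sup S by apply: ub_le_sup => //; exists u.
pose b' := Num.min u (sup S + d / 2).
have bb' : b <= b' by rewrite le_min; lra.
have b'u : b' <= u by rewrite ge_min lexx.
have Sb' : S b'.
  split => //; first exact: le_trans bb'.
  apply: (Btrans s b b') => //; apply: Bd => //.
  by apply: (@le_lt_trans _ _ (sup S + d / 2)); [rewrite ge_min lexx orbT|lra].
have : b' <= sup S by apply: ub_le_sup => //; exists u.
case: Sb' => _ _; rewrite /b'.
by case: (leP u (sup S + d / 2)) => // _ _; lra.
Qed.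

Lemma big_ord_shift (R : nmodType) (F : nat -> R) m n K : (m + n <= K)%N ->
  (forall i, (i < m)%N -> F i = 0) -> (forall i, (m + n < i <= K)%N -> F i = 0) ->
  \sum_(i < K.+1) F i = \sum_(j < n.+1) F (m + j)%N.
Proof.
move=> mnK F1 F2; rewrite -(big_mkord xpredT F).
rewrite (@big_cat_nat _ _ _ m)/=; [|lia|lia].
rewrite [X in _ + X](@big_cat_nat _ _ _ (m + n).+1)/=; [|lia|lia].
rewrite big_nat_cond big1 ?add0r; last by move=> i; rewrite andbT => ?; apply: F1; lia.
rewrite [X in _ + X]big_nat_cond [X in _ + X]big1 ?addr0; last first.
  by move=> i; rewrite andbT => ?; apply: F2; lia.
rewrite -[X in \big[_/_]_(X <= _ < _) _]add0n big_addn.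
have -> : ((m + n).+1 - m = n.+1)%N by lia.
by rewrite big_mkord; apply: eq_bigr => i _; rewrite addnC.
Qed.

(** * Transition probabilities of a branching kernel *)

Section kernel_facts.
Variables (R : realType) (l : R -> R -> natinf -> probability natinf R).
Hypothesis lP : is_branching_kernel_N l.

Implicit Types s t : R.

Definition tp s t (m n : nat) : R := fine (l s t (Some m) [set (Some n : natinf)]).

Lemma tpE s t m n : l s t (Some m) [set Some n] = (tp s t m n)%:E.
Proof. by rewrite /tp fineK// fin_num_measure. Qed.

Lemma tp_ge0 s t m n : 0 <= tp s t m n.
Proof. by rewrite -lee_fin -tpE measure_ge0. Qed.

Lemma sum_tp_le1 s t m K : \sum_(i < K) tp s t m i <= 1.
Proof.
rewrite -lee_fin -sumEFin.
under eq_bigr do rewrite -tpE.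
rewrite -(measure_semi_additive_ord_I _ (F := fun i => [set (Some i : natinf)]))//; last first.
  by move=> i j _ _ [x [/= -> []]].
exact: probability_le1.
Qed.

Lemma convNE (mu nu : probability natinf R) B :
  Defs.convN mu nu B = bindN mu (fun x => pushN nu (natinf_add x)) B.
Proof.
rewrite /Defs.convN /bindN; apply: eq_integral => x _.
by rewrite (integral_indic nu _ (A := natinf_add x @^-1` B))// setIT.
Qed.

Lemma bind_add1 (mu nu : probability natinf R) n :
  bindN mu (fun x => pushN nu (natinf_add x)) [set Some n] =
  (\sum_(i < n.+1) nu [set Some (n - i)%N] * mu [set Some (i : nat)])%E.
Proof.
rewrite bindN_finite.
- apply: eq_bigr => -[i /= ni] _; congr (nu _ * _)%E; rewrite /pushN/=.
  apply/seteqP; split => [[y|]//= [] yn|y /= ->/=]; congr Some; lia.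
- by rewrite -(measure0 nu); congr (nu _); apply/seteqP; split.
move=> i ni; rewrite -(measure0 nu); congr (nu _).
by apply/seteqP; split => // -[y|]//= [] ?; lia.
Qed.

Lemma tp_conv s t m m' n : (s, t) \in (@Delta R) ->
  tp s t (m + m') n = \sum_(i < n.+1) tp s t m i * tp s t m' (n - i).
Proof.
move=> st; apply: EFin_inj; rewrite -tpE -sumEFin.
case: lP => _ _ _ [lconv _ _]; rewrite -lconv// convNE bind_add1.
by apply: eq_bigr => i _; rewrite !tpE muleC.
Qed.

Lemma tp0 s t n : (s, t) \in (@Delta R) -> tp s t 0 n = (n == 0%N)%:R.
Proof.
move=> st; case: lP => _ _ _ [_ l0 _]; rewrite /tp l0// diracE.
by rewrite in_set1 [Some _ == _]eq_sym.
Qed.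

Lemma tp_diag s m n : 0 <= s -> tp s s m n = (n == m)%:R.
Proof.
move=> s0; case: lP => ls _ _ _; rewrite /tp ls// diracE.
by rewrite in_set1 eq_sym.
Qed.

(** The indicator of a finite point vanishes near infinity, so it is an admissible test function for
    weak continuity. *)
Lemma tp_continuous m n :
  {within @Delta R, continuous (fun st : R * R => tp st.1 st.2 m n)}.
Proof.
case: lP => _ _ lc _.
have H := lc m (\1_[set (Some n : natinf)] : natinf -> R).
have -> : (fun st : R * R => tp st.1 st.2 m n) =
   (fun st : R * R => Rintegral (l st.1 st.2 (Some m)) setT (\1_[set (Some n : natinf)])).
  apply/funext => st; rewrite /Rintegral integral_indic// setIT //.
apply: H; rewrite /natinf_continuous indicE memNset//=.
apply: cvg_near_cst; exists n.+1 => // k /= nk.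
by rewrite indicE memNset//= => -[] kn; lia.
Qed.

Lemma tp_near m n s t (e : R) : 0 < e -> 0 <= s -> s <= t -> exists2 d, 0 < d &
  forall x y, 0 <= x -> x <= y -> `|s - x| < d -> `|t - y| < d ->
     `|tp s t m n - tp x y m n| < e.
Proof.
move=> e0 s0 st.
have /subspace_continuousP/(_ (s, t) (conj s0 st)) := @tp_continuous m n.
move=> /cvgrPdist_lt/(_ _ e0).
rewrite /prop_near1/= => -[[A B] /= [/nbhs_ballP[d1 /= d10 dA] /nbhs_ballP[d2 /= d20 dB]] AB].
exists (Num.min d1 d2); first by rewrite lt_min d10.
move=> x y x0 xy; rewrite !lt_min => /andP[dx1 dx2] /andP[dy1 dy2].
by apply: (AB (x, y)) => //; split => /=; [exact: dA|exact: dB].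
Qed.

Lemma tp_diag_near m (e tau : R) : 0 < e -> 0 <= tau -> exists2 d, 0 < d &
  forall x y, 0 <= x -> x <= y -> tau - d < x -> y < tau + d ->
     1 - e < tp x y m m.
Proof.
move=> e0 tau0; have [d d0 dP] := tp_near m m e0 tau0 (lexx tau).
exists d => // x y x0 xy dx dy.
have : `|tp tau tau m m - tp x y m m| < e by apply: dP; rewrite // ltr_norml; lra.
have -> : tp tau tau m m = 1 by rewrite tp_diag// eqxx.
by rewrite ltr_norml; lra.
Qed.

(** If [m + 1] independent families have total size below [m + 1], then the first [m] of them have
    total size below [m], or the last one is empty. *)
Lemma tp_lt s t m n : (s, t) \in (@Delta R) -> tp s t 1 0 = 0 -> (n < m)%N ->
  tp s t m n = 0.
Proof.
move=> st a10; elim: m n => // m IH n nm.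
rewrite -addn1 tp_conv// big1// => -[i /= ni] _.
have [im|mi] := ltnP i m; first by rewrite IH// mul0r.
have -> : (n - i = 0)%N by lia.
by rewrite a10 mulr0.
Qed.

(** A state other than [0] at time [t] cannot lead to [0] at time [u], and the state [0] at time [t]
    has probability zero. Deaths are excluded on the two given intervals only, which is what the
    converse direction has at hand. *)
Lemma tp10_CK s t u : 0 <= s -> s <= t -> t <= u ->
  tp s t 1 0 = 0 -> tp t u 1 0 = 0 -> tp s u 1 0 = 0.
Proof.
move=> s0 st tu a1 a2; have t0 : 0 <= t by exact: le_trans st.
have D : (t, u) \in (@Delta R) by rewrite inE.
apply: EFin_inj; rewrite -tpE.
case: (lP) => _ lCK _ [_ _ lN]; rewrite -(lCK s t u)//.
rewrite (@integral_natinf_finite _ _ _ 0)//.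
- by rewrite big_ord1/= [X in (_ * X)%E]tpE a1 mule0.
- by rewrite lN// diracE memNset.
- by move=> i i0; rewrite tpE tp_lt.
Qed.

End kernel_facts.

(** * Kernels without deaths: nonnegativity of the interpolating polynomials *)

Section monotone_kernel.
Variables (R : realType) (l : R -> R -> natinf -> probability natinf R).
Hypothesis lP : is_branching_kernel_N l.
Hypothesis l10 : forall s t, (s, t) \in (@Delta R) ->
  l s t (Some 1%N) [set (Some 0%N : natinf)] = 0%E.

Implicit Types s t u x y : R.

Local Notation a := (tp l).

Let DeltaP (s t : R) : 0 <= s -> s <= t -> (s, t) \in (@Delta R).
Proof. by move=> s0 st; rewrite inE. Qed.

Let tp_lt0 s t m n : (s, t) \in (@Delta R) -> (n < m)%N -> a s t m n = 0.
Proof. by move=> st; apply: (tp_lt lP) => //; rewrite /tp l10. Qed.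

Lemma tp_CK s t u m n : 0 <= s -> s <= t -> t <= u ->
  a s u m n = \sum_(j < n.+1) a s t m j * a t u j n.
Proof.
move=> s0 st tu; have t0 : 0 <= t by exact: le_trans st.
apply: EFin_inj; rewrite -tpE -sumEFin.
case: (lP) => _ lCK _ [_ _ lN]; rewrite -(lCK s t u)//.
rewrite (@integral_natinf_finite _ _ _ n)//.
- by apply: eq_bigr => i _; rewrite !tpE muleC.
- by rewrite lN ?DeltaP// diracE memNset.
- by move=> i ni; rewrite tpE tp_lt0// DeltaP.
Qed.

Definition stay s t := a s t 1 1.
Local Notation p := stay.

Lemma stay_CK s t u : 0 <= s -> s <= t -> t <= u -> p s u = p s t * p t u.
Proof.
move=> s0 st tu; rewrite /p (tp_CK _ _ s0 st tu) big_ord_recl big_ord1/=.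
by rewrite tp_lt0 ?DeltaP// mul0r add0r.
Qed.

Lemma stay_le1 s t : p s t <= 1.
Proof.
apply: le_trans (sum_tp_le1 l s t 1 2); rewrite big_ord_recl big_ord1/=.
by rewrite lerDr tp_ge0.
Qed.

(** Positivity holds near the diagonal, where [p] is close to [1], and is carried over to long
    intervals by multiplicativity. *)
Lemma stay_gt0 s t : 0 <= s -> s <= t -> 0 < p s t.
Proof.
move=> s0 st; apply: (interval_induction (B := fun x y => 0 < p x y)) => //.
  move=> x y z sx xy yz zt pxy pyz.
  by rewrite (stay_CK _ xy yz) ?mulr_gt0// (le_trans s0).
move=> tau stau taut.
have [d d0 dP] := @tp_diag_near _ _ lP 1 1 tau ltr01 (le_trans s0 stau).
exists d => // x y sx xy yt tx ty.
by have := dP x y (le_trans s0 sx) xy tx ty; rewrite subrr.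
Qed.

(* [ntp s t m n] is the coefficient of [z^n] in [(F_{s,t}(z) / (p z))^m]. *)
Definition ntp s t m n := a s t m (m + n) / p s t ^+ m.
Local Notation b := ntp.

Lemma ntp0 s t n : (s, t) \in (@Delta R) -> b s t 0 n = (n == 0%N)%:R.
Proof. by move=> st; rewrite /b (tp0 lP)// add0n expr0 divr1. Qed.

Lemma ntp1 s t : 0 <= s -> s <= t -> b s t 1 0 = 1.
Proof.
by move=> s0 st; rewrite /b expr1 divff// gt_eqF// stay_gt0.
Qed.

Lemma ntpD s t m m' n : (s, t) \in (@Delta R) ->
  b s t (m + m') n = \sum_(i < n.+1) b s t m i * b s t m' (n - i).
Proof.
move=> st; rewrite /b (tp_conv lP)//.
rewrite (big_ord_shift (F := fun i => a s t m i * a s t m' (m + m' + n - i)%N)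
  (m := m) (n := n)).
- rewrite mulr_suml; apply: eq_bigr => -[i /= ni] _.
  have -> : (m + m' + n - (m + i) = m' + (n - i))%N by lia.
  by rewrite exprD invfM mulrACA.
- by lia.
- by move=> i im; rewrite tp_lt0// mul0r.
- by move=> i ni; rewrite [X in _ * X]tp_lt0 ?mulr0//; lia.
Qed.

(** The factor [p t u ^+ j] compensates the normalisation: the [m + j] particles present at time [t]
    are divided by [p t u ^+ (m + j)], while the left-hand side contains only the [m]th power. *)
Lemma ntp_CK s t u m n : 0 <= s -> s <= t -> t <= u ->
  b s u m n = \sum_(j < n.+1) b s t m j * p t u ^+ j * b t u (m + j) (n - j).
Proof.
move=> s0 st tu; have t0 : 0 <= t by exact: le_trans st.
rewrite /b (tp_CK _ _ s0 st tu).
rewrite (big_ord_shift (F := fun j => a s t m j * a t u j (m + n)) (m := m) (n := n)).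
- rewrite mulr_suml; apply: eq_bigr => -[j /= nj] _.
  have -> : (m + j + (n - j) = m + n)%N by lia.
  rewrite (stay_CK s0 st tu) exprMn exprD.
  have pst := stay_gt0 s0 st; have ptu := stay_gt0 t0 tu.
  by field; rewrite !expf_neq0 ?gt_eqF.
- by [].
- by move=> i im; rewrite tp_lt0 ?mul0r// DeltaP.
- by move=> i ni; lia.
Qed.

Definition incpoly s t n : {poly R} := powpoly (b s t 1) n.
Local Notation Q := incpoly.

Lemma incpoly_nat s t n m : 0 <= s -> s <= t -> (Q s t n).[m%:R] = b s t m n.
Proof.
move=> s0 st; have D := DeltaP s0 st; apply: powpoly_nat.
- by move=> k; exact: ntp0.
- by move=> *; exact: ntpD.
- exact: ntp1.
Qed.

Lemma incpoly0 s t n : 0 <= s -> s <= t -> (Q s t n).[0] = (n == 0%N)%:R.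
Proof. by move=> s0 st; rewrite (incpoly_nat n 0)// ntp0// DeltaP. Qed.

Lemma incpolyD s t n x y : 0 <= s -> s <= t ->
  (Q s t n).[x + y] = \sum_(i < n.+1) (Q s t i).[x] * (Q s t (n - i)).[y].
Proof.
move=> s0 st; have D := DeltaP s0 st; apply: powpolyD.
- by move=> k; exact: ntp0.
- by move=> *; exact: ntpD.
- exact: ntp1.
Qed.

Lemma incpoly_CK s t u n : 0 <= s -> s <= t -> t <= u ->
  Q s u n = \sum_(j < n.+1)
    (p t u ^+ j *: Q s t j) * (Q t u (n - j)%N \Po ('X + (j%:R)%:P)).
Proof.
move=> s0 st tu; have t0 : 0 <= t by exact: le_trans st.
apply: poly_eq_nat => m.
rewrite incpoly_nat//; last exact: le_trans tu.
rewrite (ntp_CK _ _ s0 st tu) horner_sum; apply: eq_bigr => j _.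
rewrite hornerM hornerZ horner_comp hornerD hornerX hornerC -natrD !incpoly_nat//.
by rewrite (mulrC (p t u ^+ j)).
Qed.

(* The coefficients of [log (F_{s,t}(z) / (p z))]. *)
Definition levy s t n := (Q s t n)^`().[0].
Local Notation c := levy.

(** Differentiate [incpoly_CK] at [0] by the product rule. Since [Q s t j] vanishes at [0] unless
    [j = 0], derivatives of the second factors leave only [c t u n]; in the other terms the power of
    [p t u] cancels the normalisation of [ntp] and gives [a t u j n]. *)
Lemma levy_CK s t u n : 0 <= s -> s <= t -> t <= u ->
  c s u n = c t u n + \sum_(j < n.+1) c s t j * a t u j n.
Proof.
move=> s0 st tu; have t0 : 0 <= t by exact: le_trans st.
rewrite /c (incpoly_CK _ s0 st tu) horner_deriv_sum.
transitivity (\sum_(j < n.+1) ((Q s t j)^`().[0] * a t u j n +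
    (j == 0%N :> nat)%:R * (Q t u n)^`().[0])).
  apply: eq_bigr => -[j /= nj] _.
  rewrite derivM hornerD !hornerM derivZ !hornerZ horner_comp hornerD hornerX hornerC add0r.
  rewrite incpoly_nat// incpoly0// deriv_comp derivD derivX derivC addr0 mulr1.
  rewrite horner_comp hornerD hornerX hornerC add0r; congr (_ + _).
    rewrite /b; have -> : (j + (n - j) = n)%N by lia.
    have ptu := stay_gt0 t0 tu.
    by field; rewrite expf_neq0// gt_eqF.
  case: j nj => [|j] nj /=; last by rewrite mulr0 !mul0r.
  by rewrite expr0 subn0 !mul1r.
rewrite big_split/= addrC; congr (_ + _).
rewrite big_ord_recl/= mul1r big1 ?addr0// => i _.
by rewrite mul0r.
Qed.

Let E N s t := \sum_(n < N.+1) Num.max 0 (- c s t n).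

(* Substochasticity of [a t u] makes the total negative part subadditive. *)
Let E_sub N s t u : 0 <= s -> s <= t -> t <= u -> E N s u <= E N s t + E N t u.
Proof.
move=> s0 st tu; have t0 : 0 <= t by exact: le_trans st.
pose e j := Num.max 0 (- c s t j).
have e0 j : 0 <= e j by rewrite le_max lexx.
rewrite /E.
apply: (@le_trans _ _ (\sum_(n < N.+1)
  (\sum_(j < N.+1) e j * a t u j n + Num.max 0 (- c t u n)))).
  apply: ler_sum => -[n /= nN] _.
  rewrite ge_max; apply/andP; split.
    rewrite addr_ge0 ?le_max ?lexx//.
    by apply: sumr_ge0 => j _; rewrite mulr_ge0// tp_ge0.
  rewrite (levy_CK _ s0 st tu) opprD addrC lerD ?le_max ?lexx ?orbT//.
  rewrite -sumrN.
  rewrite (big_ord_widen_cond N.+1 xpredT (fun j => - (c s t j * a t u j n)))//.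
  rewrite big_mkcond/=; apply: ler_sum => j _; case: ifP => _.
    by rewrite -mulNr ler_wpM2r ?tp_ge0// /e le_max lexx orbT.
  by rewrite mulr_ge0// tp_ge0.
rewrite big_split/= lerD// exchange_big/=; apply: ler_sum => j _.
by rewrite -mulr_sumr ler_piMr ?e0// sum_tp_le1.
Qed.

Let C N : R := \sum_(n < N.+1) \sum_(k < n.+1) `|(binpoly R k)^`().[0]|.

Let C_ge0 N : 0 <= C N.
Proof. by apply: sumr_ge0 => i _; apply: sumr_ge0. Qed.

(** Without deaths the mass above [1] is at most [1 - p s t], so the coefficients [b s t 1 k] with
    [k >= 1] sum to at most [(p s t)^-1 - 1]. This number serves as [rho] in
    [deriv_powpoly_lower]. *)
Let E_local N s t : 0 <= s -> s <= t -> (p s t)^-1 - 1 <= 1 ->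
  E N s t <= C N * ((p s t)^-1 - 1) ^+ 2.
Proof.
move=> s0 st p1; have D := DeltaP s0 st; have p0 := stay_gt0 s0 st.
rewrite /E /C mulr_suml; apply: ler_sum => n _.
rewrite ge_max; apply/andP; split; first by rewrite mulr_ge0 ?sqr_ge0// sumr_ge0.
rewrite lerNl -mulNr; apply: deriv_powpoly_lower => //.
  by move=> k; rewrite divr_ge0 ?tp_ge0// exprn_ge0// ltW.
rewrite /b -mulr_suml expr1.
have -> : (p s t)^-1 - 1 = (1 - p s t) / p s t by field; rewrite gt_eqF.
rewrite ler_pM2r ?invr_gt0// lerBrDr addrC.
apply: le_trans (sum_tp_le1 l s t 1 (n.+2)).
rewrite big_ord_recl/= tp_lt0// add0r big_ord_recl/= lerD2l.
by rewrite big_add1/= big_mkord.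
Qed.

(** On short intervals one factor of the square in [E_local] is at most [eta]. The resulting bound
    is linear in [p^-1 - 1], which is superadditive because [(u - 1) + (v - 1) <= u v - 1] for
    [u, v >= 1], so it passes to adjacent intervals. *)
Let E_global N s t (eta : R) : 0 <= s -> s <= t -> 0 < eta -> eta <= 1 ->
  E N s t <= C N * eta * ((p s t)^-1 - 1).
Proof.
move=> s0 st eta0 eta1.
apply: (interval_induction
  (B := fun x y => E N x y <= C N * eta * ((p x y)^-1 - 1))) => //.
  move=> x y z sx xy yz zt Exy Eyz; have x0 := le_trans s0 sx.
  have y0 := le_trans x0 xy.
  apply: le_trans (E_sub N x0 xy yz) _; apply: le_trans (lerD Exy Eyz) _.
  rewrite -mulrDr ler_wpM2l ?mulr_ge0 ?(ltW eta0)//.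
  rewrite (stay_CK x0 xy yz) invfM.
  have u1 : 1 <= (p x y)^-1 by rewrite invf_ge1 ?stay_le1 ?stay_gt0.
  have v1 : 1 <= (p y z)^-1 by rewrite invf_ge1 ?stay_le1 ?stay_gt0.
  by nra.
move=> tau stau taut; have tau0 := le_trans s0 stau.
(* For [eta <= 1], the bound [p > 1 - eta / 2] yields [p^-1 - 1 <= eta]. *)
have e0 : 0 < eta / 2 by rewrite divr_gt0.
have [d d0 dP] := @tp_diag_near _ _ lP 1 _ _ e0 tau0.
exists d => // x y sx xy yt tx ty; have x0 := le_trans s0 sx.
have := dP x y x0 xy tx ty; rewrite -/(p x y) => pe.
have p0 := stay_gt0 x0 xy; have p1 := stay_le1 x y.
have rho : (p x y)^-1 - 1 <= eta.
  by rewrite lerBlDr -[X in X <= _]mul1r ler_pdivrMr//; nra.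
have rho0 : 0 <= (p x y)^-1 - 1 by rewrite subr_ge0 invf_ge1.
apply: le_trans (E_local N x0 xy (le_trans rho eta1)) _.
by rewrite expr2 -mulrA ler_wpM2l// ler_wpM2r.
Qed.

Lemma levy_ge0 s t n : 0 <= s -> s <= t -> 0 <= c s t n.
Proof.
move=> s0 st.
have p0 := stay_gt0 s0 st; have p1 := stay_le1 s t.
have rho0 : 0 <= (p s t)^-1 - 1 by rewrite subr_ge0 invf_ge1.
have E0 : E n s t <= 0.
  pose K := C n * ((p s t)^-1 - 1).
  have K0 : 0 <= K by exact: mulr_ge0.
  apply/ler_addgt0Pr => e e0; rewrite add0r.
  (* This makes [K * eta <= e]; the [+ 1] covers the case [K = 0]. *)
  pose eta := Num.min 1 (e / (K + 1)).
  have eta0 : 0 < eta by rewrite lt_min ltr01 divr_gt0// ltr_wpDl.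
  have eta1 : eta <= 1 by rewrite ge_min lexx.
  apply: le_trans (E_global n s0 st eta0 eta1) _.
  rewrite mulrAC -/K (@le_trans _ _ (K * (e / (K + 1))))//.
    by rewrite ler_wpM2l// ge_min lexx orbT.
  rewrite mulrA ler_pdivrMr; last by rewrite ltr_wpDl.
  by nra.
have : Num.max 0 (- c s t n) <= E n s t.
  by rewrite /E big_ord_recr/= lerDr sumr_ge0// => i _; rewrite le_max lexx.
move=> /le_trans/(_ E0); rewrite ge_max => /andP[_].
by rewrite oppr_le0.
Qed.

Lemma incpoly_ge0 s t n x : 0 <= s -> s <= t -> 0 <= x -> 0 <= (Q s t n).[x].
Proof.
move=> s0 st x0; have D := DeltaP s0 st; apply: powpoly_ge0 => //.
- by move=> k; exact: ntp0.
- by move=> *; exact: ntpD.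
- exact: ntp1.
- by move=> k _; exact: levy_ge0.
Qed.

End monotone_kernel.

(** * Increment laws for real starting points *)

Section increments.
Variables (R : realType) (l : R -> R -> natinf -> probability natinf R).
Hypothesis lP : is_branching_kernel_N l.
Hypothesis l10 : forall s t, (s, t) \in (@Delta R) ->
  l s t (Some 1%N) [set (Some 0%N : natinf)] = 0%E.
Implicit Types s t u x y : R.

Local Notation p := (stay l).
Local Notation Q := (incpoly l).

Let DeltaP (s t : R) : 0 <= s -> s <= t -> (s, t) \in (@Delta R).
Proof. by move=> s0 st; rewrite inE. Qed.

(* The mass that [k_{s,t}(x, .)] gives to [x + n]. *)
Definition incw s t x (n : nat) : R := p s t `^ x * (Q s t n).[x].

Lemma incw_ge0 s t x n : 0 <= s -> s <= t -> 0 <= x -> 0 <= incw s t x n.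
Proof. by move=> s0 st x0; rewrite mulr_ge0 ?powR_ge0// incpoly_ge0. Qed.

Lemma incw_nat s t m n : 0 <= s -> s <= t -> incw s t m%:R n = tp l s t m (m + n).
Proof.
move=> s0 st; have p0 := stay_gt0 lP l10 s0 st.
rewrite /incw powR_mulrn ?ltW// incpoly_nat// /ntp mulrC divfK//.
by rewrite expf_neq0// gt_eqF.
Qed.

Lemma incwD s t x y n : 0 <= s -> s <= t ->
  incw s t (x + y) n = \sum_(i < n.+1) incw s t x i * incw s t y (n - i).
Proof.
move=> s0 st; rewrite /incw powRD; last first.
  by apply/implyP => _; rewrite gt_eqF// stay_gt0.
rewrite incpolyD// mulr_sumr; apply: eq_bigr => i _.
by rewrite mulrACA.
Qed.

Lemma incw_CK s t u x n : 0 <= s -> s <= t -> t <= u ->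
  incw s u x n = \sum_(j < n.+1) incw s t x j * incw t u (x + j%:R) (n - j).
Proof.
move=> s0 st tu; have t0 : 0 <= t by exact: le_trans st.
have ps := stay_gt0 lP l10 s0 st; have pt := stay_gt0 lP l10 t0 tu.
rewrite /incw (incpoly_CK lP l10 _ s0 st tu) horner_sum mulr_sumr.
rewrite (stay_CK lP l10 s0 st tu) powRM ?ltW//; apply: eq_bigr => j _.
rewrite hornerM hornerZ horner_comp hornerD hornerX hornerC powRD; last first.
  by apply/implyP => _; rewrite gt_eqF.
by rewrite powR_mulrn ?ltW//; ring.
Qed.

Lemma incw_x0 s t n : 0 <= s -> s <= t -> incw s t 0 n = (n == 0%N)%:R.
Proof. by move=> s0 st; rewrite /incw powRr0 incpoly0// mul1r. Qed.

Lemma incw_diag s x n : 0 <= s -> incw s s x n = (n == 0%N)%:R.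
Proof.
move=> s0; rewrite /incw /stay (tp_diag lP)// eqxx powR1 mul1r.
have -> : Q s s n = ((n == 0%N)%:R)%:P.
  apply: poly_eq_nat => m; rewrite incpoly_nat// hornerC /ntp /stay !(tp_diag lP)//.
  by rewrite eqxx expr1n divr1 -[X in _ == X]addn0 eqn_add2l.
by rewrite hornerC.
Qed.

Let S s t x K := \sum_(i < K) incw s t x i.

Let S_ge0 s t x K : 0 <= s -> s <= t -> 0 <= x -> 0 <= S s t x K.
Proof. by move=> *; apply: sumr_ge0 => i _; exact: incw_ge0. Qed.

(** The partial sums are values at [1] of truncated generating polynomials. Truncation only removes
    nonnegative terms, so the coefficients of the product are dominated by the convolution
    [incw s t (x + y)]. *)
Let S_mul s t x y K K' : 0 <= s -> s <= t -> 0 <= x -> 0 <= y ->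
  S s t x K * S s t y K' <= S s t (x + y) (K + K').
Proof.
move=> s0 st x0 y0.
pose X := \poly_(i < K) incw s t x i; pose Y := \poly_(i < K') incw s t y i.
have XE : S s t x K = X.[1].
  by rewrite horner_poly; apply: eq_bigr => i _; rewrite expr1n mulr1.
have YE : S s t y K' = Y.[1].
  by rewrite horner_poly; apply: eq_bigr => i _; rewrite expr1n mulr1.
rewrite XE YE -hornerM.
have sXY : (size (X * Y)%R <= K + K')%N.
  apply: leq_trans (size_polyMleq _ _) _.
  have sX : (size X <= K)%N by exact: size_poly.
  have sY : (size Y <= K')%N by exact: size_poly.
  by lia.
rewrite (horner_coef_wide _ sXY); apply: ler_sum => n _.
rewrite expr1n mulr1 coefM incwD//; apply: ler_sum => i _.
by apply: ler_pM; rewrite !coef_poly; do ?case: ifP => _ //; rewrite ?incw_ge0.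
Qed.

(** The successor in the number of terms retains the weight [incw s t 0 0 = 1] when [m = 0]. *)
Let S_exp s t x K m : 0 <= s -> s <= t -> 0 <= x ->
  S s t x K ^+ m <= S s t (m%:R * x) (m * K).+1.
Proof.
move=> s0 st x0; elim: m => [|m IH].
  by rewrite expr0 mul0r mul0n /S big_ord1 incw_x0.
apply: (@le_trans _ _ (S s t x K * S s t (m%:R * x) (m * K).+1)).
  by rewrite exprS ler_wpM2l// S_ge0.
have := @S_mul s t x (m%:R * x) K (m * K).+1 s0 st x0 (mulr_ge0 (ler0n _ _) x0).
have -> : x + m%:R * x = m.+1%:R * x by rewrite -natr1 mulrDl mul1r addrC.
by rewrite mulSn addnS.
Qed.

(* [S x ^ m <= S (m x) <= S q / S_1 (q - m x) <= 1 / p] with [q] the integer above [m x]. *)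
Let S_exp_bound s t x K m : 0 <= s -> s <= t -> 0 <= x ->
  S s t x K ^+ m <= (p s t)^-1.
Proof.
move=> s0 st x0; apply: le_trans (S_exp _ _ s0 st x0) _.
have p0 := stay_gt0 lP l10 s0 st.
set y := m%:R * x; have y0 : 0 <= y by rewrite mulr_ge0.
pose q := (Num.trunc y).+1.
have qy : y <= q%:R by rewrite ltW// truncnS_gt.
have yq : q%:R - y <= 1.
  by rewrite lerBlDl /q -natr1 lerD2r truncn_le.
have := @S_mul s t y (q%:R - y) (m * K).+1 1 s0 st y0.
rewrite subr_ge0 => /(_ qy); rewrite [y + _]addrC subrK => H.
rewrite -[leRHS]mul1r ler_pdivlMr//.
apply: le_trans (le_trans H _).
  rewrite ler_wpM2l ?S_ge0// /S big_ord1 /incw.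
  have -> : Q s t 0 = 1.
    apply: powpoly0.
    - by move=> k; apply: (ntp0 lP); exact: DeltaP.
    - by move=> *; apply: (ntpD lP l10); exact: DeltaP.
    - exact: (ntp1 lP l10).
  by rewrite hornerC mulr1 ger1_powR// p0 stay_le1.
rewrite /S; under eq_bigr do rewrite incw_nat//.
apply: le_trans (sum_tp_le1 l s t q (q + ((m * K).+1 + 1))).
rewrite [leRHS]big_split_ord/= lerDr; apply: sumr_ge0 => i _; exact: tp_ge0.
Qed.

Lemma bernoulli_ineq (r : R) m : 0 <= r -> 1 + m%:R * r <= (1 + r) ^+ m.
Proof.
move=> r0; elim: m => [|m IH]; first by rewrite mul0r addr0.
rewrite exprS -natr1; apply: (@le_trans _ _ ((1 + r) * (1 + m%:R * r))).
  by have : 0 <= m%:R :> R by []; nra.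
by rewrite ler_wpM2l// addr_ge0.
Qed.

(** All powers of the partial sum are bounded by the same constant [(p s t)^-1], whereas the powers
    of a number above [1] are unbounded by Bernoulli's inequality. *)
Lemma sum_incw_le1 s t x K : 0 <= s -> s <= t -> 0 <= x ->
  \sum_(i < K) incw s t x i <= 1.
Proof.
move=> s0 st x0; rewrite -/(S s t x K) leNgt; apply/negP => S1.
pose r := S s t x K - 1; have r0 : 0 < r by rewrite subr_gt0.
pose m := (Num.trunc ((p s t)^-1 / r)).+1.
have : (p s t)^-1 / r < m%:R by exact: truncnS_gt.
rewrite ltr_pdivrMr// => H.
have := S_exp_bound K m s0 st x0.
have -> : S s t x K = 1 + r by rewrite /r addrC subrK.
move=> /(le_trans (bernoulli_ineq m (ltW r0))).
by rewrite leNgt => /negP; apply; apply: lt_le_trans H _; rewrite lerDr.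
Qed.

(** The side conditions stand under the existential quantifier so that [inc] is a total function;
    where they fail, a point mass at [None] is taken. *)
Lemma inc_exists s t x : exists mu : probability natinf R,
  0 <= s -> s <= t -> 0 <= x -> forall n, mu [set Some n] = (incw s t x n)%:E.
Proof.
have [[s0 st x0]|H] := pselect [/\ 0 <= s, s <= t & 0 <= x].
  have [mu muP] := probability_of_weights
    (fun n => incw_ge0 n s0 st x0) (fun K => sum_incw_le1 K s0 st x0).
  by exists mu.
by exists (\d_(None : natinf) : probability natinf R) => s0 st x0; exfalso; apply: H.
Qed.

Definition inc s t x : probability natinf R := sval (cid (inc_exists s t x)).

Lemma inc1 s t x n : 0 <= s -> s <= t -> 0 <= x ->
  inc s t x [set Some n] = (incw s t x n)%:E.
Proof. by move=> s0 st x0; rewrite /inc; case: cid => mu /= ->. Qed.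

End increments.

(** * Measurability on the extended half-line *)

Lemma measure_natinf_series (R : realType) (mu : probability natinf R) (C : set natinf) :
  ~ C None ->
  mu C = (\sum_(0 <= n <oo) (\1_C (Some n : natinf))%:E * mu [set Some n])%E.
Proof.
move=> CN.
have CE : C = \bigcup_n (C `&` [set (Some n : natinf)]).
  apply/seteqP; split => [[n|]// Cn|x [n _ []]//]; by exists n.
rewrite {1}CE measure_semi_bigcup//; last by move=> i j _ _ [x [[_ /= ->] [_ /= []]]].
apply: eq_eseriesr => n _.
have [Cn|Cn] := pselect (C (Some n)).
  rewrite indicE mem_set// mul1e.
  by congr (mu _); apply/seteqP; split => [x []//|x /= ->].
rewrite indicE memNset// mul0e.
rewrite -(measure0 mu); congr (mu _); apply/seteqP; split => // x [+ /= xn].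
by rewrite xn.
Qed.

Section einf.
Variable R : realType.

Lemma measurable_Einf : measurable (@Einf R).
Proof.
have -> : @Einf R = [set` `[0%E, +oo[] by apply/seteqP; split => x /=; rewrite in_itv/= andbT.
exact: emeasurable_itv.
Qed.

Lemma Einf_split : @Einf R = (EFin @` `[0%R, +oo[) `|` [set +oo%E].
Proof.
apply/seteqP; split => [[r| |]|x].
- by rewrite /Einf/= lee_fin => r0; left; exists r => //=; rewrite in_itv/= r0.
- by right.
- by [].
case=> [[r /= + <-]|->]; last exact: leey.
by rewrite in_itv/= andbT /Einf/= lee_fin.
Qed.

(** The point [+oo] is a measurable singleton, so it can be split off. *)
Lemma measurable_fun_Einf d (T : measurableType d) (F : \bar R -> T) :
  measurable_fun (`[0%R, +oo[ : set R) (fun r => F r%:E) -> measurable_fun (@Einf R) F.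
Proof.
move=> mF; rewrite Einf_split.
have mE : measurable ((EFin @` `[0%R, +oo[) : set (\bar R)).
  by apply: measurable_image_EFin; exact: measurable_itv.
apply/measurable_funU => //; split; last exact: measurable_fun_set1.
apply: (@eq_measurable_fun _ _ _ _ _ ((fun r => F r%:E) \o fine)).
  by move=> x; rewrite inE => -[r _ <-].
apply: (measurable_comp (F := (`[0%R, +oo[ : set R))) => //.
by move=> _ [_ [r r0 <-] <-].
Qed.

Lemma measurable_conv_inner (nu : probability (\bar R) R) (B : set (\bar R)) :
  measurable B ->
  measurable_fun setT (fun x => \int[nu]_(y in @Einf R) (\1_B (x + y)%E : R)%:E)%E.
Proof.
move=> mB.
pose f (z : \bar R * \bar R) : \bar R := ((\1_B (z.1 + z.2)%E : R) * \1_(@Einf R) z.2)%:E.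
have -> : (fun x => \int[nu]_(y in @Einf R) (\1_B (x + y)%E : R)%:E)%E =
    (fun x => \int[nu]_y f (x, y))%E.
  apply/funext => x; rewrite integral_mkcond; apply: eq_integral => y _.
  rewrite /f/= patchE indicE; case: ifPn => yE; rewrite indicE ?yE ?mulr1//.
  by rewrite (negbTE yE) mulr0.
apply: (@measurable_fun_fubini_tonelli_F _ _ _ _ _ nu f); last first.
  by move=> z; rewrite /f lee_fin mulr_ge0.
apply/measurable_EFinP/measurable_funM.
  apply: (@measurableT_comp _ _ _ _ _ _ (\1_B : \bar R -> R)
    setT (fun z : \bar R * \bar R => (z.1 + z.2)%E)); first exact: measurable_indic.
  by apply: emeasurable_funD; [exact: measurable_fst|exact: measurable_snd].
apply: (@measurableT_comp _ _ _ _ _ _ (\1_(@Einf R) : \bar R -> R) setT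
  (@snd (\bar R) (\bar R))); last exact: measurable_snd.
by apply: measurable_indic; exact: measurable_Einf.
Qed.

End einf.

(** * The extended kernels and their algebraic identities *)

Section embedding.
Variables (R : realType) (l : R -> R -> natinf -> probability natinf R).
Hypothesis lP : is_branching_kernel_N l.
Hypothesis l10 : forall s t, (s, t) \in (@Delta R) ->
  l s t (Some 1%N) [set (Some 0%N : natinf)] = 0%E.
Implicit Types s t u x y : R.

Local Notation I := (inc lP l10).

Definition shiftE (x : R) (y : natinf) : \bar R :=
  match y with Some n => (x + n%:R)%:E | None => +oo%E end.

Lemma shiftE_ge0 x (y : natinf) : 0 <= x -> (0 <= shiftE x y)%E.
Proof. by move=> x0; case: y => [n|] //=; rewrite lee_fin addr_ge0. Qed.

Lemma shiftED x y (i j : natinf) :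
  (shiftE x i + shiftE y j)%E = shiftE (x + y) (natinf_add i j).
Proof.
by case: i j => [i|] [j|]//=; rewrite -EFinD natrD addrACA.
Qed.

Definition kE s t (x : \bar R) : probability (\bar R) R :=
  match x with
  | r%:E => pushN (I s t r) (shiftE r)
  | _ => \d_(+oo%E : \bar R)
  end.

Lemma shiftE_Einf x : 0 <= x -> shiftE x @^-1` (@Einf R) = setT.
Proof. by move=> x0; apply/seteqP; split => // y _; exact: shiftE_ge0. Qed.

Lemma kE_Einf s t (x : \bar R) : Einf x -> kE s t x (@Einf R) = 1%E.
Proof.
case: x => [r| |]; rewrite /Einf//=; last first.
  by move=> _; rewrite diracE mem_set// /=; exact: leey.
rewrite lee_fin => r0; rewrite [LHS](_ : _ = I s t r setT); last first.
  by rewrite -(shiftE_Einf r0).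
exact: probability_setT.
Qed.

Lemma measurable_stay_powR s t : 0 <= s -> s <= t ->
  measurable_fun setT (fun x => stay l s t `^ x).
Proof.
move=> s0 st; have p0 := stay_gt0 lP l10 s0 st.
have -> : (fun x => stay l s t `^ x) = expR \o (fun x => x * ln (stay l s t)).
  by apply/funext => x; rewrite /powR gt_eqF.
apply: measurableT_comp; first exact: measurable_expR.
exact: measurable_funM.
Qed.

(** Taking complements, one may assume that [B] omits [+oo]. Then the mass of [B] is the series of
    the weights [incw l s t r n] over those [n] with [r + n] in [B], and each term is measurable in
    [r]. *)
Lemma measurable_kE_fin s t (B : set (\bar R)) : 0 <= s -> s <= t -> measurable B ->
  measurable_fun (`[0%R, +oo[ : set R) (fun r => kE s t r%:E B).
Proof.
move=> s0 st; wlog BN : B / ~ B +oo%E.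
  move=> H mB; have [BN|BN] := pselect (B +oo%E); last exact: H.
  apply: (@eq_measurable_fun _ _ _ _ _ (fun r => 1 - kE s t r%:E (~` B))%E).
    move=> r _ /=; have mCB : measurable (~` B) by exact: measurableC.
    by rewrite -probability_setC// setCK.
  apply: emeasurable_funB; first exact: measurable_cst.
  by apply: H; [rewrite /setC/=; tauto|exact: measurableC].
move=> mB.
pose g (r : R) : \bar R :=
  (\sum_(0 <= n <oo) ((\1_B (r + n%:R)%:E : R) * incw l s t r n)%:E)%E.
apply: (@eq_measurable_fun _ _ _ _ _ g).
  move=> r; rewrite inE/= in_itv/= andbT => r0.
  rewrite [RHS](measure_natinf_series (I s t r) (C := shiftE r @^-1` B))//.
  by apply: eq_eseriesr => n _; rewrite EFinM inc1.
apply: ge0_emeasurable_sum.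
  move=> n r; rewrite /= in_itv/= andbT => r0 _.
  by rewrite lee_fin mulr_ge0// incw_ge0.
move=> n _; apply/measurable_EFinP; apply: measurable_funTS.
apply: measurable_funM.
  apply: (@measurableT_comp _ _ _ _ _ _ (\1_B : \bar R -> R)
    setT (fun r : R => (r + n%:R)%:E)); first exact: measurable_indic.
  by apply/measurable_EFinP; exact: measurable_funD.
apply: measurable_funM; first exact: measurable_stay_powR.
by apply: continuous_measurable_fun; exact: continuous_horner.
Qed.

Lemma measurable_kE s t (B : set (\bar R)) : 0 <= s -> s <= t -> measurable B ->
  measurable_fun (@Einf R) (fun x : \bar R => kE s t x B).
Proof.
by move=> s0 st mB; apply: measurable_fun_Einf; exact: measurable_kE_fin.
Qed.

Lemma inc_dirac s t x (C : set natinf) : 0 <= s -> s <= t -> 0 <= x ->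
  (forall n, incw l s t x n = (n == 0%N)%:R) ->
  I s t x C = \d_(Some 0%N : natinf) C.
Proof.
move=> s0 st x0 H.
rewrite (@probability_natinf_ext _ (I s t x) (\d_(Some 0%N : natinf)))// => n.
by rewrite inc1// H /= diracE in_set1 [Some _ == _]eq_sym.
Qed.

Lemma kE_diag s (x : \bar R) (B : set (\bar R)) : 0 <= s -> Einf x -> kE s s x B = \d_x B.
Proof.
move=> s0; case: x => [r| |]; rewrite /Einf//= lee_fin => r0.
rewrite /pushN inc_dirac//; last by move=> n; exact: incw_diag.
by rewrite !diracE /in_mem/= /mem/= /in_set/= addr0.
Qed.

Lemma kE_x0 s t (B : set (\bar R)) : 0 <= s -> s <= t -> kE s t 0%E B = \d_(0%E) B.
Proof.
move=> s0 st; rewrite /= /pushN inc_dirac//; last by move=> n; exact: incw_x0.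
by rewrite !diracE /in_mem/= /mem/= /in_set/= addr0.
Qed.

Lemma kE_CK s t u (x : \bar R) (B : set (\bar R)) : 0 <= s -> s <= t -> t <= u -> Einf x ->
  measurable B -> (\int[kE s t x]_(y0 in @Einf R) kE t u y0 B)%E = kE s u x B.
Proof.
move=> s0 st tu; have t0 : 0 <= t by exact: le_trans st.
have su : s <= u by exact: le_trans tu.
case: x => [r| |]; rewrite /Einf//=; last first.
  move=> _ mB; rewrite integral_dirac//=; last 2 first.
    exact: measurable_Einf.
    exact: measurable_kE.
  by rewrite diracE mem_set ?mul1e//= leey.
rewrite lee_fin => r0 mB.
rewrite ge0_integral_pushN//; last 2 first.
  exact: measurable_Einf.
  exact: measurable_kE.
rewrite shiftE_Einf//.
(* [K y] is the law of the total increment over [[s, u]] given the increment [y] over [[s, t]]: the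
   second increment starts from [r + j], and an infinite first increment stays infinite. *)
pose K (y : natinf) : probability natinf R := match y with
  | Some j => pushN (I t u (r + j%:R)) (natinf_add (Some j))
  | None => \d_(None : natinf) end.
transitivity (bindN (I s t r) K (shiftE r @^-1` B)).
  apply: eq_integral => -[j|] _ //=.
  rewrite /pushN; congr (I t u _ _); apply/seteqP; split => -[n|]//=;
    by rewrite natrD addrA.
rewrite (@probability_natinf_ext _ (bindN (I s t r) K) (I s u r))// => n.
rewrite /= bindN_finite.
- rewrite inc1// (incw_CK lP l10 _ _ s0 st tu) -sumEFin; apply: eq_bigr => -[j /= nj] _.
  rewrite [RHS]EFinM [I s t r _]inc1// [LHS]muleC; congr (_ * _)%E.
  rewrite -(inc1 lP l10)//; last by rewrite addr_ge0.
  congr (I t u _ _); apply/seteqP; split => [[y|]//= [] yn|y /= ->/=]; congr Some; lia.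
- by rewrite /K/= diracE memNset.
- move=> i ni; rewrite -(measure0 (I t u (r + i%:R))); congr (I t u _ _).
  by apply/seteqP; split => // -[y|]//= [] ?; lia.
Qed.

Lemma kE_conv s t x y (B : set (\bar R)) : 0 <= s -> s <= t -> 0 <= x -> 0 <= y ->
  measurable B -> convE (kE s t x%:E) (kE s t y%:E) B = kE s t (x + y)%:E B.
Proof.
move=> s0 st x0 y0 mB; rewrite /convE.
rewrite ge0_integral_pushN//; last 3 first.
- exact: measurable_Einf.
- apply: measurable_funTS; exact: measurable_conv_inner.
- by move=> z _; apply: integral_ge0 => z' _; rewrite lee_fin.
rewrite shiftE_Einf//.
(* Since [(x + i) + (y + j) = (x + y) + (i + j)], both sides are images under [shiftE (x + y)] of
   increment laws, whose weights [incwD] compares. *)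
transitivity (bindN (I s t x) (fun i => pushN (I s t y) (natinf_add i))
  (shiftE (x + y) @^-1` B)).
  apply: eq_integral => i _; rewrite ge0_integral_pushN//; last 2 first.
  - exact: measurable_Einf.
  - apply/measurable_EFinP; apply: measurable_funTS.
    apply: (@measurableT_comp _ _ _ _ _ _ (\1_B : \bar R -> R)
      setT (fun z : \bar R => (shiftE x i + z)%E)); first exact: measurable_indic.
    exact: emeasurable_funD.
  rewrite shiftE_Einf//.
  under eq_integral do rewrite shiftED.
  by rewrite (integral_indic (I s t y) _
    (A := natinf_add i @^-1` (shiftE (x + y) @^-1` B)))// setIT.
rewrite (@probability_natinf_ext _
  (bindN (I s t x) (fun i => pushN (I s t y) (natinf_add i))) (I s t (x + y)))// => n.
rewrite /= bind_add1 inc1 ?addr_ge0// (incwD lP l10)// -sumEFin.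
by apply: eq_bigr => j _; rewrite [RHS]EFinM !inc1// [LHS]muleC.
Qed.

Lemma kE_emb s t (n : natinf) (B : set (\bar R)) : 0 <= s -> s <= t ->
  kE s t (natinf_emb n) B = l s t n (natinf_emb @^-1` B).
Proof.
move=> s0 st; have D : (s, t) \in (@Delta R) by rewrite inE.
case: n => [n|]/=; last first.
  by case: lP => _ _ _ [_ _ ->]//; rewrite !diracE.
rewrite -(@probability_natinf_ext _ (pushN (I s t n%:R) (natinf_add (Some n)))
  (l s t (Some n))).
  rewrite /pushN; congr (I s t _ _); apply/seteqP; split => -[m|]//=;
    by rewrite natrD.
(* Below [n] neither side has mass: increments are nonnegative, and deaths are excluded. *)
move=> m; have [nm|mn] := leqP n m; last first.
  transitivity (0%E : \bar R); last by rewrite tpE (tp_lt lP)// /tp l10.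
  rewrite -(measure0 (I s t n%:R)); congr (I s t _ _).
  by apply/seteqP; split => // -[y|]//= [] ?; lia.
transitivity (I s t n%:R [set Some (m - n)%N]).
  by congr (I s t _ _); apply/seteqP; split => [[y|]//= [] yn|y /= ->/=]; congr Some; lia.
rewrite inc1// (incw_nat lP l10)// tpE; congr (tp l s t n _)%:E; lia.
Qed.

End embedding.

(** * Weak continuity of the extended kernels *)

Lemma integral_pushN (R : realType) d (T : measurableType d)
    (mu : probability natinf R) (f : natinf -> T) (D : set T) (g : T -> \bar R) :
  measurable D -> measurable_fun D g ->
  (\int[pushN mu f]_(y in D) g y = \int[mu]_(x in f @^-1` D) g (f x))%E.
Proof.
move=> mD mg; rewrite integralE [RHS]integralE.
congr (_ - _)%E.
  rewrite [LHS]ge0_integral_pushN//; last exact: measurable_funepos.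
  by apply: eq_integral => x _; rewrite !funeposE.
rewrite [LHS]ge0_integral_pushN//; last exact: measurable_funeneg.
by apply: eq_integral => x _; rewrite !funenegE.
Qed.

(** Replacing [g] by [g None] from [K] on changes it by at most [e] uniformly, and [mu] has mass
    one. The approximation involves finitely many weights of [mu], so weak continuity is reduced to
    continuity of single weights. *)
Lemma Rintegral_natinf_approx (R : realType) (mu : probability natinf R)
    (g : natinf -> R) (e : R) K :
  (forall n, (K <= n)%N -> `|g (Some n) - g None| <= e) ->
  `|Rintegral mu setT g -
    (g None + \sum_(n < K) (g (Some (n : nat)) - g None) * fine (mu [set Some (n : nat)]))|
   <= e.
Proof.
move=> ge; have e0 : 0 <= e by apply: le_trans (ge K _).
have bint (h : natinf -> R) M : (forall y, `|h y| <= M) ->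
    mu.-integrable setT (EFin \o h).
  move=> hM; apply: measurable_bounded_integrable => //.
    by rewrite [X in (X < _)%E](@probability_setT _ _ _ mu) ltry.
  by exists M; split; [exact: num_real|move=> M' MM' y _; exact: le_trans (ltW MM')].
pose c n := g (Some n) - g None.
pose s k (y : natinf) := g None + \sum_(n < k) c n * \1_[set (Some (n : nat) : natinf)] y.
have sint k : mu.-integrable setT (EFin \o s k).
  apply: (bint _ (`|g None| + \sum_(n < k) `|c n|)) => y.
  apply: le_trans (ler_normD _ _) _; rewrite lerD2l.
  apply: le_trans (ler_norm_sum _ _ _) _; apply: ler_sum => n _.
  by rewrite normrM ler_piMr// indicE; case: (_ \in _); rewrite ?normr1 ?normr0.
have iint n : mu.-integrable setT (EFin \o (\1_[set (Some n : natinf)] : natinf -> R)).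
  by apply: (bint _ 1) => y; rewrite indicE; case: (_ \in _); rewrite ?normr1 ?normr0.
have sE k : Rintegral mu setT (s k) =
    g None + \sum_(n < k) c n * fine (mu [set Some (n : nat)]).
  elim: k => [|k IH].
    rewrite (@eq_Rintegral _ _ _ _ _ (fun=> g None)).
      by rewrite Rintegral_cst// [X in fine X](@probability_setT _ _ _ mu) mulr1 big_ord0 addr0.
    by move=> y _; rewrite /s big_ord0 addr0.
  rewrite (@eq_Rintegral _ _ _ _ _ (fun y => s k y + c k * \1_[set (Some k : natinf)] y)).
    rewrite RintegralD//; last first.
      apply: (bint _ `|c k|) => y; rewrite normrM ler_piMr// indicE.
      by case: (_ \in _); rewrite ?normr1 ?normr0.
    rewrite IH RintegralZl// big_ord_recr/= addrA; congr (_ + _ * _).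
    by rewrite /Rintegral integral_indic// setIT.
  by move=> y _; rewrite /s big_ord_recr/= addrA.
rewrite -sE.
have gs y : `|g y - s K y| <= e.
  case: y => [n|]; rewrite /s.
    have [Kn|nK] := leqP K n.
      rewrite big1 ?addr0 ?ge// => i _; rewrite indicE memNset ?mulr0//= => -[] ni.
      by have := ltn_ord i; lia.
    rewrite (bigD1 (Ordinal nK))//= indicE mem_set// mulr1 big1 ?addr0.
      by rewrite /c [g None + _]addrC subrK subrr normr0.
    move=> i /eqP ni; rewrite indicE memNset ?mulr0//= => -[] nE.
    by apply: ni; apply: val_inj.
  rewrite big1 ?addr0 ?subrr ?normr0// => i _.
  by rewrite indicE memNset ?mulr0.
have gint : mu.-integrable setT (EFin \o g).
  apply: (bint _ (`|g None| + \sum_(n < K) `|c n| + e)) => y.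
  rewrite -[g y](subrK (s K y)) addrC; apply: le_trans (ler_normD _ _) _.
  apply: lerD => //.
  apply: le_trans (ler_normD _ _) _; rewrite lerD2l.
  apply: le_trans (ler_norm_sum _ _ _) _; apply: ler_sum => n _.
  by rewrite normrM ler_piMr// indicE; case: (_ \in _); rewrite ?normr1 ?normr0.
rewrite -RintegralB//; last exact: sint.
apply: (@le_trans _ _ (Rintegral mu setT (fun y => `|g y - s K y|))).
  by apply: le_normr_Rintegral => //; exact: (bint _ e).
have := @Rintegral_cst _ _ _ mu setT measurableT e.
rewrite [X in fine X](@probability_setT _ _ _ mu) mulr1 => <-.
apply: le_Rintegral => //.
  by apply: (bint _ e) => y; rewrite normr_id.
by apply: (bint _ e) => y; rewrite ger0_norm.
Qed.

Section weak_continuity.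
Variables (R : realType) (l : R -> R -> natinf -> probability natinf R).
Hypothesis lP : is_branching_kernel_N l.
Hypothesis l10 : forall s t, (s, t) \in (@Delta R) ->
  l s t (Some 1%N) [set (Some 0%N : natinf)] = 0%E.

Let D : set ((R * R) * R) := [set z | z.1 \in (@Delta R) /\ 0 <= z.2].

Let fst_within (z0 : (R * R) * R) :
  fst @ within D (nbhs z0) --> within (@Delta R) (nbhs z0.1).
Proof.
move=> A /= HA.
have H : nbhs z0 [set z : (R * R) * R | Delta z.1 -> A z.1].
  have HA' : nbhs z0.1 [set x | Delta x -> A x] by exact: HA.
  exact: (@cvg_fst _ _ (nbhs z0.1) (nbhs z0.2) _ _ HA').
rewrite /within/=; apply: filterS H => z /= H [Dz _].
by apply: H; rewrite inE in Dz.
Qed.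

Let tp_cvg m n (z0 : (R * R) * R) : D z0 ->
  (fun z : (R * R) * R => tp l z.1.1 z.1.2 m n) @ within D (nbhs z0) -->
    tp l z0.1.1 z0.1.2 m n.
Proof.
move=> [Dz0 _]; rewrite inE in Dz0.
have /subspace_continuousP/(_ _ Dz0) H := @tp_continuous _ _ lP m n.
exact: cvg_comp (@fst_within z0) H.
Qed.

Let snd_cvg (z0 : (R * R) * R) : snd @ within D (nbhs z0) --> z0.2.
Proof. by apply: cvg_within_filter; exact: cvg_snd. Qed.

Let stay0 (z0 : (R * R) * R) : D z0 -> 0 < stay l z0.1.1 z0.1.2.
Proof. by move=> [+ _]; rewrite inE => -[s0 st]; exact: stay_gt0. Qed.

(** The power of [stay] is written as [expR (x * ln p)], legitimate on [D] where [p > 0]; the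
    polynomial factor is a finite sum of products of transition probabilities, inverses of [p] and
    polynomials in [x]. *)
Lemma incw_cvg n (z0 : (R * R) * R) : D z0 ->
  (fun z : (R * R) * R => incw l z.1.1 z.1.2 z.2 n) @ within D (nbhs z0) -->
    incw l z0.1.1 z0.1.2 z0.2 n.
Proof.
move=> Dz0; apply: cvgM.
  have powE (z : (R * R) * R) : D z -> stay l z.1.1 z.1.2 `^ z.2 =
     expR (z.2 * ln (stay l z.1.1 z.1.2)).
    by move=> Dz; rewrite /powR gt_eqF// stay0.
  rewrite powE//.
  have H : (fun z : (R * R) * R => expR (z.2 * ln (stay l z.1.1 z.1.2)))
      @ within D (nbhs z0) --> expR (z0.2 * ln (stay l z0.1.1 z0.1.2)).
    apply: (@cvg_comp _ _ _ _ _ _ (nbhs (z0.2 * ln (stay l z0.1.1 z0.1.2))) _);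
      last exact: continuous_expR.
    apply: cvgM; first exact: snd_cvg.
    apply: (@cvg_comp _ _ _ _ _ _ (nbhs (stay l z0.1.1 z0.1.2)) _); first exact: tp_cvg.
    by apply: continuous_ln; exact: stay0.
  apply: cvg_trans H; apply: near_eq_cvg.
  have nE : nbhs z0 (fun z => D z ->
      expR (z.2 * ln (stay l z.1.1 z.1.2)) = stay l z.1.1 z.1.2 `^ z.2).
    by apply: filterE => z Dz; rewrite powE.
  exact: nE.
pose rp (z : (R * R) * R) :=
  \poly_(i < n.+1) (if i == 0%N then 0 else ntp l z.1.1 z.1.2 1 i).
have rpc k m : (fun z => (rp z ^+ k)`_m) @ within D (nbhs z0) --> (rp z0 ^+ k)`_m.
  elim: k m => [|k IH] m.
    under eq_fun do rewrite expr0.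
    by rewrite expr0; exact: cvg_cst.
  under eq_fun do rewrite exprS coefM.
  rewrite exprS coefM; apply: (cvg_big add_continuous) => i _; apply: cvgM => //.
  under eq_fun do rewrite coef_poly.
  rewrite coef_poly; case: ifP => _; last exact: cvg_cst.
  case: ifP => _; first exact: cvg_cst.
  rewrite /ntp; apply: cvgM; first exact: tp_cvg.
  under eq_fun do rewrite expr1.
  rewrite expr1; apply: cvgV; last exact: tp_cvg.
  by rewrite gt_eqF// stay0.
have hE (z : (R * R) * R) : (incpoly l z.1.1 z.1.2 n).[z.2] =
   \sum_(k < n.+1) (rp z ^+ k)`_n * (binpoly R k).[z.2].
  by rewrite /incpoly /powpoly horner_sum; apply: eq_bigr => k _; rewrite hornerZ.
under eq_fun do rewrite hE.
rewrite hE; apply: (cvg_big add_continuous) => k _; apply: cvgM; first exact: rpc.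
by apply: (@cvg_comp _ _ _ _ _ _ (nbhs z0.2) _); [exact: snd_cvg|exact: continuous_horner].
Qed.

Lemma kE_weak (f : \bar R -> R) : {within @Einf R, continuous f} ->
  {within D, continuous (fun z : (R * R) * R =>
    Rintegral (kE lP l10 z.1.1 z.1.2 z.2%:E) (@Einf R) f)}.
Proof.
move=> /subspace_continuousP fc; apply/subspace_continuousP => z0 Dz0.
have mf : measurable_fun (@Einf R) (EFin \o f).
  apply: measurable_fun_Einf; apply/measurable_EFinP.
  apply: subspace_continuous_measurable_fun; first exact: measurable_itv.
  apply/subspace_continuousP => r; rewrite /= in_itv/= andbT => r0.
  apply: (@cvg_comp _ _ _ (@EFin R) _ _ (within (@Einf R) (nbhs r%:E)) _); last first.
    by apply: fc; rewrite /Einf/= lee_fin.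
  move=> A; rewrite /within/= => /nbhs_EFin H.
  apply: filterS H => x H; rewrite in_itv/= andbT => x0.
  by apply: H; rewrite /Einf/= lee_fin.
have intE (z : (R * R) * R) : D z ->
   Rintegral (kE lP l10 z.1.1 z.1.2 z.2%:E) (@Einf R) f =
   Rintegral (inc lP l10 z.1.1 z.1.2 z.2) setT (fun y => f (shiftE z.2 y)).
  move=> [_ z2]; rewrite /Rintegral integral_pushN ?shiftE_Einf//.
  exact: measurable_Einf.
have fy := fc +oo%E (leey _).
apply/cvgrPdist_le => e e0; have e3 : 0 < e / 3 by rewrite divr_gt0.
have [A fA] : exists A : R, forall r, A < r -> 0 <= r -> `|f r%:E - f +oo%E| <= e / 3.
  have /cvgrPdist_le/(_ _ e3) := fy.
  rewrite /within/= => -[A [_ HA]]; exists A => r Ar r0; rewrite distrC.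
  by apply: HA; rewrite ?lte_fin// /Einf/= lee_fin.
(* For [n >= K] one has [x + n > A] for every [x >= 0], so the same truncation serves all points of
   [D]. *)
pose K := (Num.trunc A).+1.
pose J (z : (R * R) * R) := f +oo%E +
  \sum_(n < K) (f (z.2 + n%:R)%:E - f +oo%E) * incw l z.1.1 z.1.2 z.2 n.
have IJ (z : (R * R) * R) : D z ->
    `|Rintegral (kE lP l10 z.1.1 z.1.2 z.2%:E) (@Einf R) f - J z| <= e / 3.
  move=> Dz; rewrite intE//.
  have := @Rintegral_natinf_approx _ (inc lP l10 z.1.1 z.1.2 z.2)
    (fun y => f (shiftE z.2 y)) (e / 3) K.
  case: Dz; rewrite inE => -[s0 st] z2.
  have -> : J z = f (shiftE z.2 None) + \sum_(n < K) (f (shiftE z.2 (Some (n : nat))) -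
      f (shiftE z.2 None)) * fine (inc lP l10 z.1.1 z.1.2 z.2 [set Some (n : nat)]).
    by congr (_ + _); apply: eq_bigr => n _; rewrite inc1.
  apply => n Kn /=; apply: fA; last by rewrite addr_ge0.
  apply: (@lt_le_trans _ _ K%:R); first exact: truncnS_gt.
  by rewrite (@le_trans _ _ n%:R) ?ler_nat ?lerDr.
have Jc : J @ within D (nbhs z0) --> J z0.
  apply: cvgD; first exact: cvg_cst.
  apply: (cvg_big add_continuous) => n _; apply: cvgM; last exact: incw_cvg.
  apply: cvgB; last exact: cvg_cst.
  apply: (@cvg_comp _ _ _ (fun z : (R * R) * R => (z.2 + (n : nat)%:R)%:E) _ _
    (within (@Einf R) (nbhs (z0.2 + (n : nat)%:R)%:E)) _); last first.
    by apply: fc; case: Dz0 => _ z2; rewrite /Einf/= lee_fin addr_ge0.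
  have Hn : (fun z : (R * R) * R => z.2 + (n : nat)%:R) @ nbhs z0 --> z0.2 + (n : nat)%:R.
    by apply: cvgD; [exact: cvg_snd|exact: cvg_cst].
  move=> B; rewrite /within/= => /nbhs_EFin/Hn H.
  have {}H : nbhs z0 (fun z => Einf (z.2 + (n : nat)%:R)%:E -> B (z.2 + (n : nat)%:R)%:E).
    exact: H.
  apply: filterS H => z /= H [_ z2]; apply: H.
  by rewrite /Einf/= lee_fin addr_ge0.
have /cvgrPdist_le/(_ _ e3) H := Jc.
have {}H : nbhs z0 (fun z => D z -> `|J z0 - J z| <= e / 3) by exact: H.
pose I (z : (R * R) * R) := Rintegral (kE lP l10 z.1.1 z.1.2 z.2%:E) (@Einf R) f.
suff : nbhs z0 (fun z => D z -> `|I z0 - I z| <= e) by [].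
apply: filterS H => z H Dz.
have := H Dz; have := IJ z Dz; have := IJ z0 Dz0.
rewrite -/(I z) -/(I z0) !ler_norml; lra.
Qed.

Lemma embeddable_of_no_death : spatially_embeddable l.
Proof.
exists (kE lP l10); split; last first.
  by move=> s t n B; rewrite inE => -[s0 st] _ _; exact: kE_emb.
split.
- by move=> s t x _; exact: kE_Einf.
- by move=> s t B; rewrite inE => -[s0 st] mB _; exact: measurable_kE.
- by move=> s x B s0 Ex _ _; exact: kE_diag.
- by move=> *; exact: kE_CK.
split.
- exact: kE_weak.
- by move=> s t x y B; rewrite inE => -[s0 st] x0 y0 mB _; exact: kE_conv.
- by move=> s t B; rewrite inE => -[s0 st] _ _; exact: kE_x0.
- by [].
Qed.

End weak_continuity.

(** * Embeddability excludes deaths *)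

Section no_death_of_embeddable.
Variable R : realType.

(** A test function that equals [1] at one half and vanishes outside [(0, 1)]. As [fine] sends
    infinities to [0], it vanishes there too. *)
Let tent (x : \bar R) : R := Num.max 0 (1 - `|2 * fine x - 1|).

Let tent_cont : continuous (fun r : R => Num.max 0 (1 - `|2 * r - 1|)).
Proof.
move=> r.
have H : {for r, continuous (fun r : R => 1 - `|2 * r - 1|)}.
  apply: cvgB; first exact: cvg_cst.
  apply: cvg_norm; apply: cvgB; last exact: cvg_cst.
  by apply: cvgM; [exact: cvg_cst|exact: cvg_id].
have H0 : {for r, continuous (fun _ : R => 0 : R)} by exact: cst_continuous.
exact: (continuous_max H0 H).
Qed.

Let tent_out (x : \bar R) : ~ (0 < x < 1)%E -> tent x = 0.
Proof.
case: x => [r| |] H; rewrite /tent/=; apply/max_idPl.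
- have : ~~ ((0 < r) && (r < 1)) by apply/negP; rewrite -!lte_fin; exact: H.
  rewrite negb_and -!leNgt => /orP[r0|r1].
    by rewrite ler0_norm; lra.
  by rewrite ger0_norm; lra.
- by rewrite mulr0 sub0r normrN normr1 subrr.
- by rewrite mulr0 sub0r normrN normr1 subrr.
Qed.

Let tent_within : {within @Einf R, continuous tent}.
Proof.
apply/subspace_continuousP => -[r| |] //= _.
  apply: cvg_within_filter.
  have H : (fun r : R => Num.max 0 (1 - `|2 * r - 1|)) @ nbhs r --> tent r%:E.
    exact: tent_cont.
  move=> A /H HA; apply/nbhs_EFin; exact: HA.
have tent_oo : tent +oo%E = 0 by apply: tent_out => /andP[_]; rewrite ltNge leey.
apply: cvg_within_filter; apply: cvg_near_cst.
exists 1; split => //= x x1; apply: etrans (esym tent_oo); apply: tent_out.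
by move=> /andP[_]; rewrite ltNge (ltW x1).
Qed.

Let B01 : set (\bar R) := [set` `]0%E, 1%E[].

Let mB01 : measurable B01.
Proof. exact: emeasurable_itv. Qed.

Let B01_Einf : B01 `<=` Einf.
Proof. by move=> x; rewrite /B01/= in_itv/= => /andP[/ltW]. Qed.

Let m0 : measurable [set (0%E : \bar R)].
Proof. exact: emeasurable_set1. Qed.

Let zero_Einf : [set (0%E : \bar R)] `<=` Einf.
Proof. by move=> x ->; rewrite /Einf/=. Qed.

(** A sum of two nonnegative numbers is [0] only if both are, so an atom of [kap] at [0] forces one
    of [mu]. Restricting the convolution to a first summand [0] then bounds [mu B01 * mu [set 0%E]]
    by [kap B01 = 0]. *)
Lemma open_unit_null (mu kap : probability (\bar R) R) :
  (forall B, measurable B -> B `<=` Einf -> convE mu mu B = kap B) ->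
  (0 < kap [set 0%E])%E -> kap B01 = 0%E -> mu B01 = 0%E.
Proof.
move=> conv kap0 kap01.
have inner0 B : measurable B -> B `<=` Einf ->
    (\int[mu]_(y in @Einf R) (\1_B (0 + y)%E : R)%:E)%E = mu B.
  move=> mB BE; under eq_integral do rewrite add0e.
  by rewrite integral_indic ?setIidl//; exact: measurable_Einf.
have mu0 : (0 < mu [set 0%E])%E.
  rewrite lt0e measure_ge0 andbT; apply/eqP => mu0.
  move: kap0; rewrite -conv// /convE integral0_eq ?ltxx// => x Ex.
  have [->|x0] := eqVneq x 0%E; first by rewrite inner0.
  apply: integral0_eq => y Ey; rewrite indicE memNset//= => xy.
  have : (x <= x + y)%E by rewrite leeDl.
  by rewrite xy => x0'; move/eqP: x0; apply; apply/eqP; rewrite eq_le x0'.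
have : (mu B01 * mu [set 0%E] <= 0)%E.
  rewrite -[leRHS]kap01 -conv// /convE.
  pose g x := (\int[mu]_(y in @Einf R) (\1_B01 (x + y)%E : R)%:E)%E.
  have -> : (mu B01 * mu [set 0%E] = \int[mu]_(x in [set 0%E]) g x)%E.
    rewrite -integral_cst//; apply: eq_integral => x; rewrite inE/= => ->.
    by rewrite /g inner0.
  apply: ge0_subset_integral => //; first exact: measurable_Einf.
    by apply: measurable_funTS; exact: measurable_conv_inner.
  by move=> x _; apply: integral_ge0 => y _; rewrite lee_fin.
rewrite pmule_lle0// => H; apply/eqP; rewrite eq_le H measure_ge0//.
Qed.

Lemma no_death_of_embeddable (l : R -> R -> natinf -> probability natinf R) s t :
  is_branching_kernel_N l -> spatially_embeddable l ->
  (s, t) \in (@Delta R) -> tp l s t 1 0 = 0.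
Proof.
move=> lP [k [[kE km kd kCK [kw kc k0 kN]] kl]]; rewrite inE => -[s0 st].
apply: contrapT => tp_neq0.
pose S := [set u | [/\ s <= u, u <= t & tp l s u 1 0 = 0]].
have Ss : S s by split => //; rewrite (tp_diag lP).
have ubS : ubound S t by move=> b [].
have supS : has_sup S by split; [exists s|exists t].
set tau := sup S.
have s_tau : s <= tau by apply: ub_le_sup => //; exists t.
have tau_t : tau <= t by apply: ge_sup => //; exists s.
have tau0 : 0 <= tau by exact: le_trans s_tau.
(* By continuity of the death probability the supremum belongs to [S]. *)
have tp_tau : tp l s tau 1 0 = 0.
  apply/eqP; apply: contrapT => /negP; rewrite neq_lt ltNge tp_ge0/= => tp_gt0.
  have [d d0 dP] := tp_near lP 1 0 tp_gt0 s0 s_tau.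
  have [u [su ut tpu] du] := sup_adherent d0 supS.
  have utau : u <= tau by apply: ub_le_sup => //; exists t.
  have := dP s u s0 su; rewrite subrr normr0 => /(_ d0).
  rewrite ger0_norm ?subr_ge0// => /(_ ltac:(rewrite /tau; lra)).
  by rewrite tpu subr0 gtr0_norm// ltxx.
have tau_lt : tau < t.
  by rewrite lt_neqAle tau_t andbT; apply/eqP => E; rewrite E in tp_tau.
(* Otherwise [tp10_CK] would put [u] into [S], beyond its supremum. *)
have tp_pos u : tau < u -> u <= t -> 0 < tp l tau u 1 0.
  move=> tu ut; rewrite lt0r tp_ge0 andbT; apply/eqP => H.
  have : S u.
    split => //; first exact: le_trans (ltW tu).
    exact: (tp10_CK lP s0 s_tau (ltW tu)).
  by move=> Su; have : u <= tau by [apply: ub_le_sup => //; exists t]; lra.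
(* The convolution square of the law started at one half is the law started at [1]; the latter is
   carried by [natinf] and charges [0]. *)
have null u : tau < u -> u <= t -> k tau u (2^-1)%:E B01 = 0%E.
  move=> tu ut; have D : (tau, u) \in (@Delta R) by rewrite inE; split => //; exact: ltW.
  apply: (open_unit_null (kap := k tau u 1%:E)).
  - by move=> B mB BE; rewrite kc//; congr (k tau u _%:E B); lra.
  - rewrite -[1%:E]/(natinf_emb (Some 1%N)) kl//.
    have -> : natinf_emb @^-1` [set (0%E : \bar R)] = [set Some 0%N].
      apply/seteqP; split => [[n|]//= [] /eqP|x /= -> //].
      by rewrite pnatr_eq0 => /eqP ->.
    by rewrite tpE lte_fin tp_pos.
  - rewrite -[1%:E]/(natinf_emb (Some 1%N)) kl//.
    rewrite -(measure0 (l tau u (Some 1%N))); congr (l tau u _ _).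
    apply/seteqP; split => // -[n|]; rewrite /B01/= in_itv/= ?lte_fin.
      by rewrite ltr0n ltrn1 => /andP[]; case: n.
    by move=> /andP[_]; rewrite ltNge leey.
have mtent : measurable_fun (@Einf R) (EFin \o tent).
  apply: measurable_fun_Einf; apply/measurable_EFinP; apply: measurable_funTS.
  by apply: continuous_measurable_fun; exact: tent_cont.
have int0 u : tau < u -> u <= t -> Rintegral (k tau u (2^-1)%:E) (@Einf R) tent = 0.
  move=> tu ut; rewrite /Rintegral.
  suff -> : (\int[k tau u (2^-1)%:E]_(x in @Einf R) (tent x)%:E = 0)%E by [].
  have mE := @measurable_Einf R.
  apply/eqP; rewrite eq_le; apply/andP; split; last first.
    by apply: integral_ge0 => x _; rewrite lee_fin le_max lexx.
  rewrite -[leRHS](null u tu ut) -(setIidl B01_Einf) -integral_indic//.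
  apply: ge0_le_integral => //.
  - by move=> x _; rewrite lee_fin le_max lexx.
  - by apply/measurable_EFinP; apply: measurable_funTS; exact: measurable_indic.
  - move=> x _; rewrite lee_fin indicE; case: (boolP (x \in B01)) => [_|]; last first.
      by rewrite notin_setE /B01/= in_itv/= => H; rewrite tent_out.
    by rewrite ge_max ler01/= gerBl.
have int1 : Rintegral (k tau tau (2^-1)%:E) (@Einf R) tent = 1.
  have Eh : Einf ((2^-1)%:E : \bar R) by rewrite /Einf/= lee_fin.
  rewrite /Rintegral (eq_measure_integral (\d_((2^-1)%:E : \bar R))); last first.
    by move=> A mA AE; exact: kd.
  rewrite integral_dirac//; last exact: measurable_Einf.
  rewrite diracE mem_set// mul1e /= /tent /= divff// subrr normr0 subr0.
  by apply/max_idPr; exact: ler01.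
have /subspace_continuousP := kw _ tent_within.
have D0 : (tau, tau) \in (@Delta R) by rewrite inE.
have h0 : 0 <= 2^-1 :> R by rewrite invr_ge0.
move=> /(_ ((tau, tau), 2^-1) (conj D0 h0)) /cvgrPdist_lt/(_ 1 ltr01) H.
have {}H : nbhs ((tau, tau), 2^-1 : R) (fun z : (R * R) * R =>
   z.1 \in (@Delta R) /\ 0 <= z.2 ->
   `|Rintegral (k tau tau (2^-1)%:E) (@Einf R) tent -
     Rintegral (k z.1.1 z.1.2 z.2%:E) (@Einf R) tent| < 1) by exact: H.
have /nbhs_ballP[d /= d0 dP] := H.
(* A time after [tau] at which the integral of [tent] is [0], yet so close to [tau] that it should
   differ by less than [1] from its value [1] at [tau]. *)
pose u := Num.min t (tau + d / 2).
have tu : tau < u by rewrite lt_min tau_lt/=; lra.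
have ut : u <= t by rewrite ge_min lexx.
have ud : u <= tau + d / 2 by rewrite ge_min lexx orbT.
have ub : ball tau d u by rewrite /ball/= ltr0_norm ?subr_lt0// opprB; lra.
have := dP ((tau, u), 2^-1) (conj (conj (ballxx _ d0) ub) (ballxx _ d0)).
rewrite /= int1 int0// subr0 normr1 ltxx.
have D : (tau, u) \in (@Delta R) by rewrite inE; split => //; exact: ltW.
by move=> /(_ (conj D h0)).
Qed.

End no_death_of_embeddable.

(** * Generating functions at zero and monotone paths *)

Lemma pgf_at0 (R : realType) (l : R -> R -> natinf -> probability natinf R) s t :
  pgf l s t 0 = tp l s t 1 0.
Proof.
apply/cvg_lim => //; apply: cvg_near_cst; exists 1%N => // n /= n0.
(* The constant term survives at [z = 0] because [0 ^+ 0 = 1]. *)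
rewrite -(prednK n0) big_nat_recl//= expr0 mulr1 big1 ?addr0// => i _.
by rewrite expr0n/= mulr0.
Qed.

Section markov.
Context (R : realType) d (Omega : measurableType d).
Variables (l : R -> R -> natinf -> probability natinf R)
  (N : R -> Omega -> natinf) (P : R -> natinf -> probability Omega R).
Hypothesis NP : is_markov_family l N P.

Let measurable_N r (C : set natinf) : 0 <= r -> measurable (N r @^-1` C).
Proof.
by move=> r0; case: NP => mN _ _; rewrite -[X in measurable X]setTI; exact: mN.
Qed.

(** The Markov property is applied to the indicator of [Some m] and the event [N t = i], on which
    the conditional expectation is the constant [l t u i [set Some m]]. *)
Lemma markov_joint s t u x (i : natinf) (m : nat) : 0 <= s -> s <= t -> t <= u ->
  P s x (N u @^-1` [set Some m] `&` N t @^-1` [set i]) =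
  (l t u i [set Some m] * P s x (N t @^-1` [set i]))%E.
Proof.
move=> s0 st tu; have t0 : 0 <= t by exact: le_trans st.
have u0 : 0 <= u by exact: le_trans tu.
pose f : natinf -> R := \1_[set (Some m : natinf)].
case: (NP) => _ _ /(_ s t u x f s0 st tu).
have fM : exists M : R, forall y, `|f y| <= M.
  by exists 1 => y; rewrite /f indicE; case: (_ \in _); rewrite ?normr1 ?normr0.
move=> /(_ fM (N t @^-1` [set i])).
have sA : natural_sigma N s t (N t @^-1` [set i]).
  by apply: sub_gen_smallest; exists t, [set i].
move=> /(_ sA).
rewrite (integral_indic (P s x) _ (A := N u @^-1` [set Some m])); last 2 first.
- exact: measurable_N.
- exact: measurable_N.
move=> ->.
rewrite (eq_integral (cst (l t u i [set Some m]))); last first.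
  move=> w; rewrite inE/= => ->.
  by rewrite /Rintegral /f integral_indic// setIT fineK// fin_num_measure.
by rewrite integral_cst//; exact: measurable_N.
Qed.

(** Pairs in increasing order contribute the empty set, so that the union may run over all pairs. A
    finite target [m] suffices, since no path decreases to infinity. *)
Let dead_pair t u (j : natinf) (m : nat) : set Omega :=
  if `[< natinf_le j (Some m) >] then set0
  else N u @^-1` [set Some m] `&` N t @^-1` [set j].

Let decode (k : nat) : natinf := if k is k'.+1 then Some k' else None.

Let decreaseE t u : [set w | natinf_le (N t w) (N u w)] =
  ~` \bigcup_k \bigcup_m dead_pair t u (decode k) m.
Proof.
apply/seteqP; split => [w /= tu [k _ [m _]]|w /= H].
  rewrite /dead_pair; case: asboolP => // kt [/= Nu Nt].
  by apply: kt; rewrite -Nt -Nu.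
apply: contrapT => tu; apply: H.
case Nu: (N u w) => [m|]; last by exfalso; apply: tu; rewrite Nu; case: (N t w).
exists (if N t w is Some k then k.+1 else 0%N) => //; exists m => //.
have -> : decode (if N t w is Some k then k.+1 else 0%N) = N t w by case: (N t w).
by rewrite /dead_pair; case: asboolP => // tm; rewrite Nu in tu.
Qed.

Let measurable_dead_pair t u j m : 0 <= t -> 0 <= u -> measurable (dead_pair t u j m).
Proof.
move=> t0 u0; rewrite /dead_pair; case: asboolP => // _.
by apply: measurableI; exact: measurable_N.
Qed.

Let measurable_decrease t u : 0 <= t -> 0 <= u ->
  measurable (\bigcup_k \bigcup_m dead_pair t u (decode k) m).
Proof.
move=> t0 u0; apply: bigcupT_measurable => k; apply: bigcupT_measurable => m.
exact: measurable_dead_pair.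
Qed.

(** Forwards, a decrease is a countable union of events that are null by [markov_joint], with
    infinity absorbing. Backwards, the path condition is used at the times [s, s, t]: as [N s = n]
    almost surely, the joint law reduces to [l s t (Some n)]. *)
Lemma monotone_paths_iff : is_branching_kernel_N l ->
  (forall s t (m n : nat), (s, t) \in (@Delta R) -> (m < n)%N ->
     l s t (Some n) [set (Some m : natinf)] = 0%E) <->
  (forall s t u (n : nat), 0 <= s -> s <= t -> t <= u ->
     P s (Some n) [set w | natinf_le (N t w) (N u w)] = 1%E).
Proof.
move=> lP; split => [H s t u n s0 st tu|H s t m n].
  have t0 : 0 <= t by exact: le_trans st.
  have u0 : 0 <= u by exact: le_trans tu.
  have D : (t, u) \in (@Delta R) by rewrite inE.
  have mU := measurable_decrease t0 u0.
  rewrite decreaseE probability_setC//.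
  suff -> : P s (Some n) (\bigcup_k \bigcup_m dead_pair t u (decode k) m) = 0%E.
    by rewrite sube0.
  apply/(negligibleP _ mU).
  apply: negligible_bigcup => k; apply: negligible_bigcup => m.
  apply/negligibleP; first exact: measurable_dead_pair.
  rewrite /dead_pair; case: asboolP => [_|km]; first exact: measure0.
  apply: etrans (markov_joint _ _ _ s0 st tu) _; move: km; case: (decode k) => [j|] /= jm.
    by rewrite H ?mul0e// ltnNge; apply/negP.
  by case: lP => _ _ _ [_ _ ->]//; rewrite diracE memNset ?mul0e.
rewrite inE => -[s0 st] mn; have t0 : 0 <= t by exact: le_trans st.
have mU := measurable_decrease s0 t0.
have := H s s t n s0 (lexx s) st.
rewrite decreaseE probability_setC// => HU.
have {}HU : P s (Some n) (\bigcup_k \bigcup_m dead_pair s t (decode k) m) = 0%E.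
  have fin : P s (Some n) (\bigcup_k \bigcup_m dead_pair s t (decode k) m) \is a fin_num.
    exact: fin_num_measure.
  move: HU; rewrite -(fineK fin) -EFinB => -[] HU.
  by congr EFin; lra.
have := @markov_joint s s t (Some n) (Some n) m s0 (lexx s) st.
case: (NP) => _ + _ => /(_ s (Some n) s0).
rewrite -[X in P _ _ X]/(N s @^-1` [set Some n]) => ->; rewrite mule1 => <-.
apply/eqP; rewrite eq_le measure_ge0 andbT -HU le_measure// ?inE//.
  by apply: measurableI; exact: measurable_N.
move=> w [/= Nt Ns]; exists n.+1 => //; exists m => //.
rewrite /dead_pair; case: asboolP => //= nm.
by move: mn; rewrite ltnNge nm.
Qed.

End markov.

(** * Equivalence of the four conditions *)

Theorem mainTheorem19 (R : realType) (d : measure_display) (Omega : measurableType d)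
  (l : R -> R -> natinf -> probability natinf R)
  (N : R -> Omega -> natinf) (P : R -> natinf -> probability Omega R) :
  is_branching_process l N P ->
  [/\ spatially_embeddable l <->
        (forall s t, (s, t) \in (@Delta R) -> pgf l s t 0 = 0),
      spatially_embeddable l <->
        (forall s t (m n : nat), (s, t) \in (@Delta R) -> (m < n)%N ->
           l s t (Some n) [set (Some m : natinf)] = 0%E)
    & spatially_embeddable l <->
        (forall s t u (n : nat), 0 <= s -> s <= t -> t <= u ->
           P s (Some n) [set w | natinf_le (N t w) (N u w)] = 1%E)].
Proof.
move=> [NP lP].
have ii : spatially_embeddable l <->
    (forall s t, (s, t) \in (@Delta R) -> tp l s t 1 0 = 0).
  split => [emb s t st|H]; first exact: no_death_of_embeddable.
  by apply: (embeddable_of_no_death lP) => s t st; rewrite tpE H.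
have iii : spatially_embeddable l <->
    (forall s t (m n : nat), (s, t) \in (@Delta R) -> (m < n)%N ->
      l s t (Some n) [set (Some m : natinf)] = 0%E).
  apply: (iff_trans ii); split => [H s t m n st mn|H s t st].
    by rewrite tpE (tp_lt lP)// H.
  by rewrite /tp H.
split => //.
- apply: (iff_trans ii); split => H s t st; first by rewrite pgf_at0 H.
  by rewrite -pgf_at0 H.
- exact: iff_trans iii (monotone_paths_iff NP lP).
Qed.
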